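(* Up to isomorphism there are exactly four amalgams of type $\mathcal U_4$, and precisely two of these are faithful. For every $n\geqslant 5$ there is, up to isomorphism, a unique amalgam of type $\mathcal U_n$.
   Context: For $n\geqslant 4$ let $H=\mathrm{AGL}_n(2)=R\rtimes A$ with $R\cong C_2^n$ the translation subgroup and $A\cong L_n(2)=\mathrm{GL}_n(2)$. Pick nontrivial $r,s\in R$ with $r\neq s$ and let $B_n=N_H(\langle r\rangle)$ and $C_n=N_H(\langle r,s\rangle)$. Set $\mathcal U_n=\{B_n,C_n\}$. An amalgam $\{A_1,A_2\}$ is a pair of groups together with their intersection $A_1\cap A_2$ (a subgroup of both, on which the two group operations agree). Two amalgams $\{A_1,A_2\}$, $\{A_1',A_2'\}$ have the same type (in the sense of Goldschmidt) if for $i=1,2$ there is an isomorphism $A_i\to A_i'$ mapping $A_1\cap A_2$ onto $A_1'\cap A_2'$ (the two isomorphisms need not agree on $A_1\cap A_2$). An amalgam is of type $\mathcal U_n$ if it has the same type as $\mathcal U_n$. Two amalgams $\{A_1,A_2\}$, $\{A_1',A_2'\}$ are isomorphic if there is a bijection $\varphi:A_1\cup A_2\to A_1'\cup A_2'$ mapping $A_i$ onto $A_i'$ such that $\varphi(ab)=\varphi(a)\varphi(b)$ for all $a,b\in A_i$, $i=1,2$. An amalgam is faithful if $A_1\cap A_2$ contains no nontrivial subgroup that is normal in both $A_1$ and $A_2$. *)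

(* Defs.v *)
From HB Require Import structures.
From mathcomp Require Import all_boot all_order all_algebra all_fingroup.
Set Implicit Arguments.
Unset Strict Implicit.
Unset Printing Implicit Defensive.
Import GroupScope.

(* A finite group whose underlying set is a subset of T: the group structure
   is carried by sg_gT, and sg_in identifies its elements with elements of T. *)
Record set_group (T : finType) := SetGroup {
  sg_gT : finGroupType;
  sg_in : sg_gT -> T;
  sg_inj : injective sg_in
}.
Arguments sg_in {T} s x.

Definition gset (T : finType) (P : set_group T) : {set T} :=
  [set sg_in P x | x : sg_gT P].

(* Two groups on subsets of one set whose intersection is a subgroup of both,
   with the same induced operation. Finite groups suffice below: a group
   isomorphic to a finite group is finite, so the amalgams having the type of a
   finite amalgam are all finite. Elements of am_T outside the union of the two
   groups play no role. *)
Record amalgam := Amalgam {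
  am_T : finType;
  am1 : set_group am_T;
  am2 : set_group am_T;
  am_int1 : group_set (sg_in am1 @^-1: gset am2);
  am_int2 : group_set (sg_in am2 @^-1: gset am1);
  am_agree : forall (x1 y1 : sg_gT am1) (x2 y2 : sg_gT am2),
    sg_in am1 x1 = sg_in am2 x2 -> sg_in am1 y1 = sg_in am2 y2 ->
    sg_in am1 (x1 * y1) = sg_in am2 (x2 * y2)
}.

Definition am_union (M : amalgam) : {set am_T M} :=
  gset (am1 M) :|: gset (am2 M).

(* The intersection, as a subgroup of the first and of the second group. *)
Definition inter1 (M : amalgam) : {group sg_gT (am1 M)} := Group (am_int1 M).
Definition inter2 (M : amalgam) : {group sg_gT (am2 M)} := Group (am_int2 M).

Definition iso_mapping (gT gT' : finGroupType) (I : {set gT}) (I' : {set gT'}) :=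
  exists f : {morphism [set: gT] >-> gT'},
    isom [set: gT] [set: gT'] f /\ f @: I = I'.

Definition same_type (M M' : amalgam) : Prop :=
  iso_mapping (inter1 M) (inter1 M') /\ iso_mapping (inter2 M) (inter2 M').

Definition maps_group_onto (T T' : finType) (phi : T -> T')
    (P : set_group T) (P' : set_group T') : Prop :=
  phi @: gset P = gset P' /\
  forall (a b : sg_gT P) (a' b' : sg_gT P'),
    phi (sg_in P a) = sg_in P' a' -> phi (sg_in P b) = sg_in P' b' ->
    phi (sg_in P (a * b)) = sg_in P' (a' * b').

(* The bijection between the unions is the restriction of phi; surjectivity
   follows from the two conditions maps_group_onto. *)
Definition amalgam_iso (M M' : amalgam) : Prop :=
  exists phi : am_T M -> am_T M',
    [/\ {in am_union M &, injective phi},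
        maps_group_onto phi (am1 M) (am1 M')
      & maps_group_onto phi (am2 M) (am2 M')].

(* K1 and K2 are the same set K, seen in the first and in the second group;
   such a K automatically lies in the intersection. *)
Definition faithful_amalgam (M : amalgam) : Prop :=
  forall (K1 : {group sg_gT (am1 M)}) (K2 : {group sg_gT (am2 M)}),
    sg_in (am1 M) @: K1 = sg_in (am2 M) @: K2 ->
    K1 <| [set: sg_gT (am1 M)] -> K2 <| [set: sg_gT (am2 M)] ->
    K1 :=: 1.

Definition exactly_up_to_iso (k : nat) (P : amalgam -> Prop) : Prop :=
  exists F : 'I_k -> amalgam,
    [/\ forall i, P (F i),
        forall i j, amalgam_iso (F i) (F j) -> i = j
      & forall M, P M -> exists i, amalgam_iso M (F i)].

Section SubgroupAmalgam.
Variables (gT : finGroupType) (B C : {group gT}).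

Definition subgroup_in (G : {group gT}) : set_group gT :=
  @SetGroup gT (subg_of G) sgval (@subg_inj gT G).

Lemma gset_subgroup_in (G : {group gT}) : gset (subgroup_in G) = G.
Proof.
apply/setP=> x; apply/imsetP/idP => [[y _ ->]|xG]; first exact: subgP.
by exists (subg G x); rewrite ?inE //= subgK.
Qed.

Lemma subgroup_int (G K : {group gT}) :
  group_set (sg_in (subgroup_in G) @^-1: gset (subgroup_in K)).
Proof.
rewrite gset_subgroup_in; apply/group_setP; split=> [|x y].
  by rewrite inE /= group1.
by rewrite !inE /=; apply: groupM.
Qed.

Lemma subgroup_agree (x1 y1 : subg_of B) (x2 y2 : subg_of C) :
  sgval x1 = sgval x2 -> sgval y1 = sgval y2 ->
  sgval (x1 * y1) = sgval (x2 * y2).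
Proof. by move=> /= -> ->. Qed.

Definition subgroup_amalgam : amalgam :=
  @Amalgam gT (subgroup_in B) (subgroup_in C)
    (subgroup_int B C) (subgroup_int C B) subgroup_agree.
End SubgroupAmalgam.

Section AffineGroup.
Variable n : nat.

Definition translations : {set {perm 'rV['F_2]_n}} :=
  [set g : {perm 'rV['F_2]_n} |
     [exists v : 'rV['F_2]_n, [forall x, g x == (x + v)%R]]].

Definition AGL_set : {set {perm 'rV['F_2]_n}} :=
  [set g : {perm 'rV['F_2]_n} | [exists A : 'M['F_2]_n, (A \in unitmx) &&
     [exists v : 'rV['F_2]_n, [forall x, g x == (x *m A + v)%R]]]].

Lemma AGL_group_set : group_set AGL_set.
Proof.
apply/group_setP; split=> [|g h].
  rewrite inE; apply/existsP; exists 1%:M%R; rewrite unitmx1.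
  apply/existsP; exists 0%R; apply/forallP=> x.
  by rewrite perm1 mulmx1 GRing.addr0.
rewrite !inE => /existsP[A /andP[uA /existsP[v /forallP gE]]].
move=> /existsP[A' /andP[uA' /existsP[v' /forallP hE]]].
apply/existsP; exists (A *m A')%R; rewrite unitmx_mul uA uA'.
apply/existsP; exists (v *m A' + v')%R; apply/forallP=> x.
by rewrite permM (eqP (hE _)) (eqP (gE _)) mulmxDl mulmxA GRing.addrA.
Qed.

Canonical AGL : {group {perm 'rV['F_2]_n}} := Group AGL_group_set.

Definition amalgam_U (r s : {perm 'rV['F_2]_n}) : amalgam :=
  subgroup_amalgam 'N_AGL(<[r]>)%G 'N_AGL(<<[set r; s]>>)%G.
End AffineGroup.

Definition of_type_U (n : nat) (r s : {perm 'rV['F_2]_n}) (M : amalgam) : Prop :=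
  same_type M (amalgam_U r s).

(* Main.v *)
Require Import Defs.
From HB Require Import structures.
From mathcomp Require Import all_boot all_order all_algebra all_fingroup.
Set Implicit Arguments.
Unset Strict Implicit.
Unset Printing Implicit Defensive.
Import GroupScope.

(* Write V for F_2^n, r and s for the translations by a and b, W for the span of a and b, and
   I for the intersection of the stabilisers B and C. Two amalgams of the given type
   differ by the automorphism of I along which B and C are glued, so the proof computes
   Aut(I).

   The subgroups {1, r} and W (as translations) are the first two terms of the upper central
   series of I, hence invariant under an automorphism al. This forces al(V) to be a
   self-centralising normal abelian subgroup acting trivially on W and on V/W. For n >= 5 it
   follows that al(V) = V; for n = 4 either al(V) = V or al(V) is the conjugate of V under
   the non-affine permutation pi of V that adds a outside W. After composing with an inner
   automorphism (and conjugation by pi) al fixes V pointwise, so al(g) = g * d(g) for a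
   derivation d from I to V. Commutation relations between transvections make d, modulo
   inner derivations, a homomorphism from I to {1, r} that factors through GL(V/W). For n
   >= 5 every transvection of V/W is a commutator, so d is trivial and al is inner; for n
   = 4 the group GL(V/W) is S_3 and d is a power of its sign character. So for n = 4 the
   outer classes are twist i j for two bits i and j. Those with (i, j) <> (0, 0) extend
   neither to B nor to C, which yields four amalgams; V is normal in both groups if i = 0,
   and no nontrivial common normal subgroup survives if i = 1. *)

(** * Vectors and linear functionals over F_2 *)

Section BinaryVectors.
Variable n : nat.
Local Notation V := 'rV['F_2]_n.
Implicit Types (x y u v w k : V) (S : {set V}) (c : bool) (s : seq V).
Local Open Scope ring_scope.

Definition bit (z : 'F_2) : bool := z != 0.

Lemma F2P (z : 'F_2) : z = 0 \/ z = 1.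
Proof. by case: z => [[|[|m]] lt_m2] //; [left | right]; apply/val_inj. Qed.

Lemma bitD : {morph bit : y z / y + z >-> y (+) z}.
Proof. by move=> y z; case: (F2P y) (F2P z) => -> [] ->. Qed.

Lemma bit_inj : injective bit.
Proof. by move=> y z; case: (F2P y) (F2P z) => -> [] ->. Qed.

Definition coord (i : 'I_n) (x : V) : bool := locked (bit (x ord0 i)).
Definition sc c u : V := if c then u else 0.
Definition dot k x : bool := locked (bit ((x *m k^T) ord0 ord0)).

Lemma coordE i x : coord i x = bit (x ord0 i).
Proof. by rewrite /coord -lock. Qed.
Lemma dotE k x : dot k x = bit ((x *m k^T) ord0 ord0).
Proof. by rewrite /dot -lock. Qed.

Lemma vecP x y : (forall i, coord i x = coord i y) -> x = y.
Proof. by move=> eq_xy; apply/rowP=> i; apply: bit_inj; rewrite -!coordE. Qed.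

Lemma coordD i x y : coord i (x + y) = coord i x (+) coord i y.
Proof. by rewrite !coordE mxE bitD. Qed.
Lemma coord0 i : coord i 0 = false.
Proof. by rewrite !coordE mxE. Qed.
Lemma coord_sc i c u : coord i (sc c u) = c && coord i u.
Proof. by case: c; rewrite //= coord0. Qed.

Lemma dotD k x y : dot k (x + y) = dot k x (+) dot k y.
Proof. by rewrite !dotE mulmxDl mxE bitD. Qed.
Lemma dot0 k : dot k 0 = false.
Proof. by rewrite dotE mul0mx mxE. Qed.
Lemma dot_sc k c u : dot k (sc c u) = c && dot k u.
Proof. by case: c; rewrite //= dot0. Qed.
Lemma dotC k x : dot k x = dot x k.
Proof. by rewrite !dotE -[in RHS](trmxK (k *m _)) trmx_mul trmxK [in RHS]mxE. Qed.
Lemma dotDl k l x : dot (k + l) x = dot k x (+) dot l x.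
Proof. by rewrite dotC dotD !(dotC x). Qed.
Lemma dot0l x : dot 0 x = false.
Proof. by rewrite dotC dot0. Qed.
Lemma dot_scl c u x : dot (sc c u) x = c && dot u x.
Proof. by rewrite dotC dot_sc dotC. Qed.

End BinaryVectors.

Definition vecE := (coordD, coord_sc, coord0, dotD, dot_sc, dot0, dotDl, dot_scl, dot0l,
  addbF, addFb, addTb, addbT, andbT, andTb, andbF, andFb).

(* Identities between vectors over F_2 become Boolean identities in their coordinates. *)
Ltac bool_cases :=
  repeat match goal with
  | |- context [coord ?i ?x] => case: (coord i x)
  | |- context [dot ?k ?x] => case: (dot k x)
  | |- context [?c && _] => is_var c; case: (c)
  | |- context [?c (+) _] => is_var c; case: (c)
  | |- context [_ (+) ?c] => is_var c; case: (c)
  end; try reflexivity.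
Ltac vec_eq := apply/vecP=> ?; rewrite ?vecE //=; bool_cases.

Section BinaryVectors2.
Variable n : nat.
Local Notation V := 'rV['F_2]_n.
Implicit Types (x y u v w k : V) (S : {set V}) (c : bool) (s : seq V).
Local Open Scope ring_scope.

Lemma addxx x : x + x = 0. Proof. vec_eq. Qed.
Lemma addvK x y : x + y + y = x. Proof. vec_eq. Qed.
Lemma addKv x y : y + (y + x) = x. Proof. vec_eq. Qed.
Lemma addv_eq0 x y : (x + y == 0) = (x == y).
Proof. by apply/eqP/eqP=> [e|->]; [rewrite -(addvK x y) e GRing.add0r | rewrite addxx]. Qed.
Lemma addv_eq x y z : (x + y == z) = (x == y + z).
Proof. by rewrite -(addv_eq0 (x + y)) -(addv_eq0 x) GRing.addrA. Qed.

Lemma addv_id x y : (x + y == x) = (y == 0).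
Proof. by rewrite -(addv_eq0 (x + y)) GRing.addrAC addxx GRing.add0r. Qed.
Lemma sc_eq0 c x : x != 0 -> (sc c x == 0) = ~~ c.
Proof. by case: c => /= [/negPf|]; rewrite ?eqxx. Qed.
Lemma scD c d x : sc c x + sc d x = sc (c (+) d) x.
Proof. by vec_eq. Qed.

Definition add_closed S := 0 \in S /\ {in S &, forall x y, x + y \in S}.

(** [M] is the row space spanned by S; a column of its cokernel that does not annihilate x is the
    required functional. *)
Lemma separation S x : add_closed S -> x \notin S ->
  exists2 k, {in S, forall y, dot k y = false} & dot k x.
Proof.
move=> [S0 SD] xS; pose M := (\sum_(y in S) <<y>>)%MS.
(* The only scalars are 0 and 1, so a closed set contains every linear combination of its
   elements. *)
have: ~~ (x <= M)%MS.
  apply: contra xS => /sub_sumsmxP[u ->].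
  elim/big_ind: _ => // y yS.
  have /sub_rVP[z ->] : (u y *m <<y>>%MS <= y)%MS.
    by apply: submx_trans (submxMl _ _) _; rewrite genmxE.
  by case: (F2P z) => ->; rewrite ?GRing.scale0r ?GRing.scale1r.
rewrite submxE => /rowV0Pn[z /submxP[c ->] nz].
have{nz} [j nzj] : exists j, (x *m cokermx M) ord0 j != 0.
  apply/existsP; apply: contraNT nz; rewrite negb_exists => /forallP H.
  rewrite (_ : x *m _ = 0) ?mulmx0 //; apply/rowP=> j; rewrite [RHS]mxE.
  by apply/eqP; move: (H j); rewrite negbK.
exists (col j (cokermx M))^T => [y yS|]; rewrite dotE trmxK colE mulmxA -colE mxE /bit //.
suff -> : y *m cokermx M = 0 by rewrite mxE.
apply/eqP; rewrite -submxE; apply: (sumsmx_sup y) => //; by rewrite genmxE.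
Qed.

(** Over F_2, adjoining v to a span adds at most one further coset, so membership unfolds to a
    Boolean disjunction. *)
Fixpoint spn s : {set V} :=
  if s is v :: s' then [set x | (x \in spn s') || (x + v \in spn s')] else [set 0].

Lemma span_closed s : add_closed (spn s).
Proof.
elim: s => [|v s [S0 SD]] /=.
  by split=> [|x y]; rewrite !inE // => /eqP-> /eqP->; rewrite GRing.addr0.
split=> [|x y]; rewrite !inE ?S0 // => /orP[xS|xS] /orP[yS|yS].
- by rewrite SD.
- by rewrite -GRing.addrA (SD x (y+v)) ?orbT.
- by rewrite GRing.addrAC (SD (x+v) y) ?orbT.
by have := SD _ _ xS yS; rewrite GRing.addrACA addxx GRing.addr0 => ->.
Qed.

Lemma mem_span s x : x \in s -> x \in spn s.
Proof.
elim: s => //= v s IHs; rewrite !inE => /predU1P[->|/IHs-> //].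
by rewrite addxx; case: (span_closed s) => -> _; rewrite orbT.
Qed.

Lemma span_consE v s : spn (v :: s) = spn s :|: [set x + v | x in spn s].
Proof.
apply/setP=> x; rewrite !inE; congr (_ || _); apply/idP/imsetP => [xs|[y ys ->]].
  by exists (x + v); rewrite ?addvK.
by rewrite addvK.
Qed.

Lemma card_span s : (#|spn s| <= 2 ^ size s)%N.
Proof.
elim: s => [|v s IHs]; first by rewrite cards1.
rewrite span_consE expnS mul2n -addnn (leq_trans (leq_card_setU _ _)) // leq_add //.
by rewrite (leq_trans (leq_imset_card _ _)).
Qed.

Lemma card_span_cons v s : v \notin spn s -> #|spn (v :: s)| = (2 * #|spn s|)%N.
Proof.
move=> vs; have [_ SD] := span_closed s.
rewrite span_consE cardsU mul2n -addnn card_imset; last exact: GRing.addIr.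
rewrite (_ : _ :&: _ = set0) ?cards0 ?subn0 //; apply/setP=> x; rewrite !inE.
apply/negP=> /andP[xs /imsetP[y ys xE]]; case/negP: vs.
by rewrite (_ : v = x + y) ?SD // xE; vec_eq.
Qed.

Lemma span_proper s : (size s < n)%N -> exists x, x \notin spn s.
Proof.
move=> lt_sn; apply/existsP; rewrite -negb_forall; apply/negP=> /forallP all_s.
have: (2 ^ n <= 2 ^ size s)%N.
  apply: leq_trans (card_span s); rewrite (_ : spn s = setT).
    by rewrite cardsT card_mx card_Fp // mul1n.
  by apply/setP=> x; rewrite all_s inE.
by rewrite leq_exp2l // leqNgt lt_sn.
Qed.

Lemma separation_span s x : x \notin spn s ->
  exists2 k, all (fun y => ~~ dot k y) s & dot k x.
Proof.
move/(separation (span_closed s)) => [k ks kx]; exists k => //.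
by apply/allP=> y /mem_span/ks ->.
Qed.

Lemma annihilator s : (size s < n)%N ->
  exists2 k, all (fun y => ~~ dot k y) s & k != 0.
Proof.
move=> /span_proper[x /separation_span[k ks kx]]; exists k => //.
by apply: contraTneq kx => ->; rewrite dot0l.
Qed.

Lemma dot_neq0 k : k != 0 -> exists x, dot k x.
Proof.
move=> nzk; have: k \notin spn [::] by rewrite inE.
by case/separation_span=> x _; rewrite dotC; exists x.
Qed.

(** The complement of the kernel of f is its translate by any x with f(x) = 1, so a functional that
    kills the kernel but not x equals f. *)
Lemma functional_dot (f : V -> bool) :
  {morph f : x y / x + y >-> x (+) y} -> exists k, f =1 dot k.
Proof.
move=> fD; have f0: f 0 = false by have := fD 0 0; rewrite GRing.addr0 addbb.
case: (pickP f) => [x fx|f_0]; last by exists 0 => x; rewrite dot0l f_0.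
have []: exists2 k, {in [set y | ~~ f y], forall y, dot k y = false} & dot k x.
  apply: separation; rewrite ?inE ?fx //; split; rewrite ?inE ?f0 // => y z.
  by rewrite !inE fD => /negPf-> /negPf->.
move=> k k0 kx; exists k => y; case fy: (f y); last by rewrite k0 // inE fy.
have /k0: x + y \in [set y | ~~ f y] by rewrite inE fD fx fy.
by rewrite dotD kx; case: (dot k y).
Qed.
End BinaryVectors2.

(** * Affine permutations *)

Section AffinePerms.
Variable n : nat.
Local Notation V := 'rV['F_2]_n.
Local Notation P := {perm V}.
Implicit Types (x y u v w k : V) (g h : P) (S : {set V}) (c : bool) (s : seq V).
Local Notation "x + y" := (GRing.add x y).
Local Notation "0" := (GRing.zero).

(* Locked, since unification would otherwise see a sum in [lin g x] and rewrite inside it. *)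
Definition lin g x : V := locked (g x + g 0).
Lemma lin_def g x : lin g x = g x + g 0.
Proof. by rewrite /lin -lock. Qed.
Definition affine g := forall x y, g (x + y) = g x + g y + g 0.

Lemma linD g : affine g -> {morph lin g : x y / x + y}.
Proof. by move=> aff_g x y; rewrite !lin_def aff_g; vec_eq. Qed.
Lemma lin0 g : lin g 0 = 0.
Proof. by rewrite lin_def addxx. Qed.
Lemma lin_sc g c u : lin g (sc c u) = sc c (lin g u).
Proof. by case: c => //=; rewrite lin0. Qed.
Lemma linE g x : g x = lin g x + g 0.
Proof. by rewrite lin_def addvK. Qed.
Lemma lin1 x : lin 1 x = x.
Proof. by rewrite !lin_def !perm1 GRing.addr0. Qed.
Lemma affE g x y : affine g -> g (x + y) = lin g x + g y.
Proof. by move=> ag; rewrite ag lin_def; vec_eq. Qed.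
Lemma lin_inj g : injective (lin g).
Proof. by move=> x y; rewrite !lin_def => /GRing.addIr/perm_inj. Qed.
Lemma linM g h x : affine h -> lin (g * h) x = lin h (lin g x).
Proof. by move=> ah; rewrite !lin_def !permM !ah; vec_eq. Qed.

(** This replaces matrices by an additive identity; conversely, the images of the standard basis
    under [lin g] are the rows of a matrix for g. *)
Lemma AGLP g : reflect (affine g) (g \in AGL n).
Proof.
rewrite inE; apply: (iffP idP) => [|aff_g].
  case/existsP=> A /andP[_ /existsP[v /forallP gE]] x y.
  by rewrite !(eqP (gE _)) mulmxDl mul0mx; vec_eq.
pose A : 'M['F_2]_n := (\matrix_i lin g (delta_mx ord0 i))%R.
have AE x : (x *m A = lin g x)%R.
  rewrite mulmx_sum_row [in RHS](row_sum_delta x).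
  rewrite (big_morph (lin g) (linD aff_g) (lin0 g)); apply: eq_bigr => i _.
  by rewrite rowK; case: (F2P (x ord0 i)) => ->; rewrite ?GRing.scale0r ?GRing.scale1r ?lin0.
apply/existsP; exists A; apply/andP; split.
  rewrite -row_free_unit; apply: inj_row_free => x; rewrite AE => gx0.
  by apply: (@lin_inj g); rewrite gx0 lin0.
apply/existsP; exists (g 0); apply/forallP=> x; by rewrite AE lin_def addvK.
Qed.

Lemma affineM g h : affine g -> affine h -> affine (g * h).
Proof. by move=> /AGLP ag /AGLP ah; apply/AGLP/groupM. Qed.
Lemma affineV g : affine g -> affine g^-1.
Proof. by move=> /AGLP ag; apply/AGLP; rewrite groupV. Qed.

Lemma linVK g x : affine g -> lin g (lin g^-1 x) = x.
Proof. by move=> ag; rewrite -linM // mulVg lin1. Qed.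
Lemma linKV g x : affine g -> lin g^-1 (lin g x) = x.
Proof. by move=> ag; rewrite -linM ?mulgV ?lin1 //; apply: affineV. Qed.

Lemma trK v : involutive (fun x => x + v).
Proof. by move=> x; apply: addvK. Qed.
Definition tr v : P := locked (perm (can_inj (trK v))).
Lemma trE v x : tr v x = x + v. Proof. by rewrite /tr -lock permE. Qed.

(* Outside [dot k u = false] this is the identity rather than x + k(x) u. *)
Definition tv_fun k u x := x + sc (dot k x && ~~ dot k u) u.
Lemma tvK k u : involutive (tv_fun k u).
Proof.
move=> x; rewrite /tv_fun; case ku: (dot k u); rewrite /= ?andbF ?andbT.
  by vec_eq.
by rewrite !vecE ku; vec_eq.
Qed.
Definition tv k u : P := locked (perm (can_inj (tvK k u))).
Lemma tv_funE k u x : tv k u x = tv_fun k u x.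
Proof. by rewrite /tv -lock permE. Qed.
Lemma tvE k u x : dot k u = false -> tv k u x = x + sc (dot k x) u.
Proof. by rewrite tv_funE /tv_fun => ->; rewrite andbT. Qed.

Lemma tr_affine v : affine (tr v).
Proof. by move=> x y; rewrite !trE; vec_eq. Qed.
Lemma lin_tr v x : lin (tr v) x = x.
Proof. by rewrite lin_def !trE; vec_eq. Qed.
Lemma tv_affine k u : affine (tv k u).
Proof. by move=> x y; rewrite !tv_funE /tv_fun !vecE; vec_eq. Qed.
Lemma tv0 k u : tv k u 0 = 0.
Proof. by rewrite tv_funE /tv_fun !vecE; vec_eq. Qed.
Lemma lin_tv k u x : lin (tv k u) x = tv k u x.
Proof. by rewrite lin_def tv0 GRing.addr0. Qed.
Lemma tr0 : tr 0 = 1.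
Proof. by apply/permP=> x; rewrite trE perm1 GRing.addr0. Qed.
Lemma trM v w : tr v * tr w = tr (v + w).
Proof. by apply/permP=> x; rewrite permM !trE; vec_eq. Qed.
Lemma tr_inj : injective tr.
Proof. by move=> v w /permP/(_ 0); rewrite !trE !GRing.add0r. Qed.
Lemma trV v : (tr v)^-1 = tr v.
Proof. by apply/eqP; rewrite eq_invg_mul trM addxx tr0. Qed.
Lemma tvV k u : (tv k u)^-1 = tv k u.
Proof. by apply/eqP; rewrite eq_invg_mul; apply/eqP/permP=> x; rewrite permM !tv_funE tvK perm1. Qed.
Lemma tv_invK k u x : tv k u (tv k u x) = x.
Proof. by rewrite !tv_funE tvK. Qed.
Lemma trJ v g : affine g -> tr v ^ g = tr (lin g v).
Proof.
move=> ag; apply/permP=> x; rewrite conjgE !permM !trE GRing.addrC affE //.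
by rewrite permKV GRing.addrC.
Qed.
Lemma lin_tvJ g k u x : affine g -> lin (g ^ tv k u) x = tv k u (lin g (tv k u x)).
Proof.
move=> ag; have at_ := tv_affine k u.
by rewrite conjgE tvV (linM _ _ (affineM ag at_)) (linM _ _ at_) !lin_tv.
Qed.
Lemma trJ_tv k u v : dot k u = false -> tr v ^ tv k u = tr (v + sc (dot k v) u).
Proof. by move=> ku; rewrite (trJ _ (@tv_affine k u)) lin_tv tvE. Qed.
Lemma lin_trP g : affine g -> lin g =1 id -> g = tr (g 0).
Proof. by move=> ag g1; apply/permP=> x; rewrite trE linE g1. Qed.
Lemma lin_eq g h : lin g =1 lin h -> h = g * tr (g 0 + h 0).
Proof. by move=> gh; apply/permP=> x; rewrite permM trE (linE h x) -gh (linE g x); vec_eq. Qed.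

Lemma translationsP g : reflect (exists v, g = tr v) (g \in translations n).
Proof.
rewrite inE; apply: (iffP existsP) => [[v /forallP gE]|[v ->]]; exists v.
  by apply/permP=> x; rewrite (eqP (gE x)) trE.
by apply/forallP=> x; rewrite trE.
Qed.
End AffinePerms.

(** * Automorphisms of a subgroup as functions on the ambient group *)

Section SelfEmbeddings.
Variable gT : finGroupType.
Implicit Types (G : {group gT}) (f : gT -> gT).

(* Since G is finite, such an f restricts to an automorphism of G; its values outside G are
   irrelevant. *)
Definition autG (G : {set gT}) f :=
  [/\ {in G &, {morph f : x y / x * y}}, {in G &, injective f} & {in G, forall x, f x \in G}].

Lemma autG1 G f : autG G f -> f 1 = 1.
Proof. by case=> fM _ _; apply: (mulgI (f 1)); rewrite -fM ?group1 // !mulg1. Qed.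

Lemma autGV G f x : autG G f -> x \in G -> f x^-1 = (f x)^-1.
Proof.
move=> af Gx; case: (af) => fM _ _; apply: (mulgI (f x)).
by rewrite -fM ?groupV // !mulgV (autG1 af).
Qed.

Lemma autGJ G f x y : autG G f -> x \in G -> y \in G -> f (x ^ y) = f x ^ f y.
Proof.
move=> af Gx Gy; case: (af) => fM _ _.
by rewrite !conjgE !fM ?groupM ?groupV // (autGV af).
Qed.

Lemma autG_surj G f y : autG G f -> y \in G -> exists2 x, x \in G & f x = y.
Proof.
case=> _ inj_f fG Gy; have: y \in f @: G.
  suff -> : f @: G = G by [].
  apply/eqP; rewrite eqEcard card_in_imset // leqnn andbT.
  by apply/subsetP=> _ /imsetP[x Gx ->]; apply: fG.
by case/imsetP=> x Gx ->; exists x.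
Qed.

Lemma autG_id G : autG G id.
Proof. by split. Qed.

Lemma autG_conj G z : z \in G -> autG G (conjg^~ z).
Proof. by move=> Gz; split=> [x y _ _|x y _ _ /conjg_inj|x Gx]; rewrite ?conjMg ?groupJ. Qed.

Lemma autG_comp G f1 f2 : autG G f1 -> autG G f2 -> autG G (f1 \o f2).
Proof.
case=> f1M f1I f1G [f2M f2I f2G]; split=> [x y Gx Gy|x y Gx Gy|x Gx] /=.
- by rewrite f2M // f1M ?f2G.
- by move/f1I => /(_ (f2G _ Gx) (f2G _ Gy)) /f2I ->.
by rewrite f1G ?f2G.
Qed.
End SelfEmbeddings.

(** * Amalgams and gluing automorphisms *)

Section AmalgamIsomorphisms.
Variables M N : amalgam.

Definition sg_iso (P Q : finGroupType) (f : P -> Q) := bijective f /\ {morph f : x y / x * y}.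

Definition compatible (f1 : sg_gT (am1 M) -> sg_gT (am1 N)) (f2 : sg_gT (am2 M) -> sg_gT (am2 N)) :=
  forall x1 x2, sg_in (am1 M) x1 = sg_in (am2 M) x2 <-> sg_in (am1 N) (f1 x1) = sg_in (am2 N) (f2 x2).

(** The bijection is assembled from two group isomorphisms; compatibility makes them agree on the
    intersection and prevents new coincidences elsewhere. *)
Lemma amalgam_isoI f1 f2 : sg_iso f1 -> sg_iso f2 -> compatible f1 f2 -> amalgam_iso M N.
Proof.
move=> [bij1 f1M] [bij2 f2M] f12.
(* On the intersection the first branch is taken; the last value, used outside the union, is
   arbitrary. *)
pose phi t := if [pick x | sg_in (am1 M) x == t] is Some x then sg_in (am1 N) (f1 x) else
  if [pick x | sg_in (am2 M) x == t] is Some x then sg_in (am2 N) (f2 x) else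
  sg_in (am1 N) 1.
have phi1 x : phi (sg_in (am1 M) x) = sg_in (am1 N) (f1 x).
  rewrite /phi; case: pickP => [y /eqP/sg_inj-> //|/(_ x)].
  by rewrite eqxx.
have phi2 x : phi (sg_in (am2 M) x) = sg_in (am2 N) (f2 x).
  rewrite /phi; case: pickP => [y /eqP/f12 //|_].
  by case: pickP => [y /eqP/sg_inj-> //|/(_ x)]; rewrite eqxx.
have img (P Q : finGroupType) (T T' : finType) (p : P -> T) (q : Q -> T') (f : P -> Q) (h : T -> T') :
    bijective f -> (forall x, h (p x) = q (f x)) -> h @: [set p x | x : P] = [set q x | x : Q].
  move=> [g fK gK] hE; apply/setP=> z; apply/imsetP/imsetP => [[_ /imsetP[x _ ->] ->]|[y _ ->]].
    by exists (f x).
  by exists (p (g y)); rewrite ?imset_f // hE gK.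
exists phi; split=> [s t||].
- rewrite !inE => /orP[] /imsetP[x _ ->] /orP[] /imsetP[y _ ->]; rewrite ?phi1 ?phi2.
  + by move/sg_inj/(bij_inj bij1)->.
  + by move/f12.
  + by move/esym/f12.
  + by move/sg_inj/(bij_inj bij2)->.
- split; first exact: img bij1 phi1.
  by move=> x y x' y'; rewrite !phi1 => /sg_inj<- /sg_inj<-; rewrite f1M.
- split; first exact: img bij2 phi2.
  by move=> x y x' y'; rewrite !phi2 => /sg_inj<- /sg_inj<-; rewrite f2M.
Qed.

Lemma maps_group_ontoE (T T' : finType) (phi : T -> T') (P : set_group T) (Q : set_group T') :
  maps_group_onto phi P Q -> {in gset P &, injective phi} ->
  exists2 f : sg_gT P -> sg_gT Q, sg_iso f & forall x, phi (sg_in P x) = sg_in Q (f x).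
Proof.
move=> [phiPQ phiM] phi_inj.
have inP x : sg_in P x \in gset P by rewrite imset_f.
have [f fE] : exists f : sg_gT P -> sg_gT Q, forall x, phi (sg_in P x) = sg_in Q (f x).
  apply: (@fin_all_exists _ _ (fun x y => phi (sg_in P x) = sg_in Q y)) => x.
  have : phi (sg_in P x) \in gset Q by rewrite -phiPQ imset_f.
  by case/imsetP=> y _ ->; exists y.
have f_inj : injective f.
  by move=> x y fxy; apply/(@sg_inj _ P)/phi_inj; rewrite ?inP // !fE fxy.
exists f => //; split; last first.
  by move=> x y; apply/(@sg_inj _ Q); rewrite -fE; apply: phiM; apply: fE.
have f_surj y : exists x, f x == y.
  have : sg_in Q y \in phi @: gset P by rewrite phiPQ imset_f.
  case/imsetP=> _ /imsetP[x _ ->] yE; exists x; apply/eqP/(@sg_inj _ Q).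
  by rewrite -fE yE.
by exists (fun y => xchoose (f_surj y)) => x; [apply: f_inj|]; apply/eqP/(xchooseP (f_surj _)).
Qed.

Lemma amalgam_isoE : amalgam_iso M N -> exists f1 f2, [/\ sg_iso f1, sg_iso f2 & compatible f1 f2].
Proof.
move=> [phi [phi_inj phi1 phi2]].
have sub1 : gset (am1 M) \subset am_union M by rewrite subsetUl.
have sub2 : gset (am2 M) \subset am_union M by rewrite subsetUr.
have [f1 iso1 f1E] := maps_group_ontoE phi1 (sub_in2 (subsetP sub1) phi_inj).
have [f2 iso2 f2E] := maps_group_ontoE phi2 (sub_in2 (subsetP sub2) phi_inj).
exists f1, f2; split=> // x1 x2; rewrite -f1E -f2E; split=> [-> //|].
by apply: phi_inj; [apply: (subsetP sub1) | apply: (subsetP sub2)]; rewrite imset_f.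
Qed.
End AmalgamIsomorphisms.

(** A common normal subgroup of N is pulled back along both group isomorphisms, and compatibility
    identifies the two preimages in M. *)
Lemma faithful_iso M N : amalgam_iso M N -> faithful_amalgam M -> faithful_amalgam N.
Proof.
move=> /amalgam_isoE[f1 [f2 [iso1 iso2 f12]]] fM K1 K2 eK nK1 nK2.
have pre (P Q : finGroupType) (f : P -> Q) (K : {group Q}) : sg_iso f -> K <| [set: Q] ->
    exists L : {group P}, L <| [set: P] /\ f @: L = K.
  move=> [bijf fm] nK; have [g fK gK] := bijf.
  have fone : f 1 = 1 by apply: (mulgI (f 1)); rewrite -fm !mulg1.
  have fV x : f x^-1 = (f x)^-1 by apply: (mulgI (f x)); rewrite -fm !mulgV fone.
  have gL : group_set (f @^-1: K).
    by apply/group_setP; split=> [|x y]; rewrite !inE ?fone ?group1 // fm => *; rewrite groupM.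
  exists (Group gL); split=> //=.
    rewrite /normal subsetT; apply/subsetP=> x _; rewrite inE; apply/subsetP=> _ /imsetP[y Ky ->].
    rewrite inE in Ky; rewrite inE conjgE !fm fV -conjgE memJ_norm //.
    by case/andP: nK => _ /subsetP; apply; rewrite inE.
  apply/setP=> y; apply/imsetP/idP => [[x + ->]|Ky]; first by rewrite inE.
  by exists (g y); rewrite ?inE gK.
have [L1 [nL1 fL1]] := pre _ _ _ _ iso1 nK1.
have [L2 [nL2 fL2]] := pre _ _ _ _ iso2 nK2.
have L11 : L1 :=: 1.
  apply: (fM L1 L2) => //; apply/setP=> z; apply/imsetP/imsetP => [[x Lx ->]|[x Lx ->]].
    have : sg_in (am1 N) (f1 x) \in sg_in (am2 N) @: K2.
      by rewrite -eK imset_f // -fL1 imset_f.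
    case/imsetP=> y2 Ky2; rewrite -fL2 in Ky2; case/imsetP: Ky2 => x2 Lx2 -> /f12 e.
    by exists x2.
  have : sg_in (am2 N) (f2 x) \in sg_in (am1 N) @: K1.
    by rewrite eK imset_f // -fL2 imset_f.
  case/imsetP=> y1 Ky1; rewrite -fL1 in Ky1; case/imsetP: Ky1 => x1 Lx1 -> /esym/f12 e.
  by exists x1.
have [_ f1M] := iso1.
rewrite -fL1 L11 imset_set1; congr [set _].
by apply: (mulgI (f1 1)); rewrite -f1M !mulg1.
Qed.

(* B sits in the first summand; an element y of B :&: C, seen in C, is glued to al y. *)
Section TwistedAmalgam.
Variables (gT : finGroupType) (B C : {group gT}) (al : gT -> gT).
Hypothesis aut_al : autG (B :&: C) al.

Definition tw_in1 (x : subg_of B) : gT + gT := inl (sgval x).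
Definition tw_in2 (x : subg_of C) : gT + gT :=
  if sgval x \in B then inl (al (sgval x)) else inr (sgval x).

Lemma tw_inj1 : injective tw_in1.
Proof. by move=> x y [/subg_inj]. Qed.

Lemma tw_inj2 : injective tw_in2.
Proof.
case: aut_al => _ inj_al _ x y; rewrite /tw_in2.
case: ifP => Bx; case: ifP => By // [e]; apply: subg_inj => //.
by apply: inj_al => //; rewrite inE ?Bx ?By subgP.
Qed.

Definition tw1 := SetGroup tw_inj1.
Definition tw2 := SetGroup tw_inj2.

Lemma tw_gset2 x : (tw_in1 x \in gset tw2) = (sgval x \in C).
Proof.
apply/imsetP/idP => [[y _]|Cx].
  rewrite /tw1 /= /tw_in1 /tw_in2; case: ifP => // By [->].
  have : sgval y \in B :&: C by rewrite inE By subgP.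
  by case: aut_al => _ _ alI /alI /setIP[].
have Ix : sgval x \in B :&: C by rewrite inE subgP.
have [y Iy e] := autG_surj aut_al Ix; have [By Cy] := setIP Iy.
by exists (subg C y) => //=; rewrite /tw_in2 /tw_in1 subgK // By e.
Qed.

Lemma tw_gset1 x : (tw_in2 x \in gset tw1) = (sgval x \in B).
Proof.
apply/imsetP/idP => [[y _]|Bx]; first by rewrite /tw_in2; case: ifP.
have : al (sgval x) \in B :&: C by case: aut_al => _ _; apply; rewrite inE Bx subgP.
by case/setIP=> By _; exists (subg B (al (sgval x))) => //=; rewrite /tw_in1 /tw_in2 Bx subgK.
Qed.

Lemma tw_int1 : group_set (sg_in tw1 @^-1: gset tw2).
Proof.
apply/group_setP; split=> [|x y]; rewrite inE ?tw_gset2 ?group1 //.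
by move=> Cx; rewrite !inE !tw_gset2; apply: groupM.
Qed.

Lemma tw_int2 : group_set (sg_in tw2 @^-1: gset tw1).
Proof.
apply/group_setP; split=> [|x y]; rewrite inE ?tw_gset1 ?group1 //.
by move=> Cx; rewrite !inE !tw_gset1; apply: groupM.
Qed.

Lemma tw_in12 (x : subg_of B) (y : subg_of C) :
  tw_in1 x = tw_in2 y <-> sgval y \in B /\ sgval x = al (sgval y).
Proof.
rewrite /tw_in1 /tw_in2; case: ifP => By; last by split=> [|[]].
by split=> [[->]|[_ ->]].
Qed.

Lemma tw_agree (x1 y1 : sg_gT tw1) (x2 y2 : sg_gT tw2) :
  sg_in tw1 x1 = sg_in tw2 x2 -> sg_in tw1 y1 = sg_in tw2 y2 ->
  sg_in tw1 (x1 * y1) = sg_in tw2 (x2 * y2).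
Proof.
case/tw_in12=> Bx ex /tw_in12[By ey]; apply/tw_in12.
by case: aut_al => alM _ _; rewrite /= groupM // ex ey alM // inE ?Bx ?By subgP.
Qed.

Definition tw_amalgam : amalgam := Amalgam tw_int1 tw_int2 tw_agree.

Lemma same_type_tw : same_type tw_amalgam (subgroup_amalgam B C).
Proof.
have idiso (hT : finGroupType) (I J : {set hT}) : I = J -> iso_mapping I J.
  move=> ->; exists (idm_morphism [set: hT]); split; last by rewrite imset_id.
  by apply/isomP; split; [apply: injm_idm | apply: im_idm].
split; apply: idiso; apply/setP=> x; rewrite !inE.
  by rewrite gset_subgroup_in tw_gset2.
by rewrite gset_subgroup_in tw_gset1.
Qed.

(** Subgroups of [subg_of B] and [subg_of C] are transported to gT, where being the same set in the
    amalgam becomes K1 = al(K2). *)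
Lemma tw_faithful : faithful_amalgam tw_amalgam <->
  (forall K1 K2 : {group gT}, K1 \subset B :&: C -> K2 \subset B :&: C ->
    B \subset 'N(K1) -> C \subset 'N(K2) -> K1 :=: al @: K2 -> K1 :=: 1).
Proof.
split=> [faith K1 K2 /subsetP sK1 /subsetP sK2 nK1 nK2 eK|core K1 K2 eK nK1 nK2].
  pose L1 := (@sgval gT B @*^-1 K1)%G; pose L2 := (@sgval gT C @*^-1 K2)%G.
  have inL (G K : {group gT}) x : (x \in @sgval gT G @*^-1 K) = (sgval x \in K).
    by rewrite !inE.
  have nL (G K : {group gT}) : G \subset 'N(K) -> @sgval gT G @*^-1 K <| [set: subg_of G].
    move=> nK; rewrite /normal subsetT; apply/subsetP=> x _; rewrite inE; apply/subsetP=> y.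
    rewrite mem_conjg !inL -[sgval (y ^ _)]/(sgval y ^ (sgval x)^-1).
    by rewrite memJ_norm // groupV (subsetP nK) ?subgP.
  suff L1_1 : L1 :=: 1.
    apply/trivgP/subsetP=> x Kx; have [Bx _] := setIP (sK1 _ Kx).
    have : subg B x \in L1 by rewrite inL subgK.
    rewrite L1_1 !inE => /eqP e; have <- : sgval (subg B x) = x by rewrite subgK.
    by rewrite e.
  apply: (faith L1 L2); rewrite ?nL //; apply/setP=> z.
  apply/imsetP/imsetP => [[x + ->]|[y + ->]]; rewrite inL => Kx.
    have : sgval x \in al @: K2 by rewrite -eK.
    case/imsetP=> y Ky e; have [By Cy] := setIP (sK2 _ Ky).
    by exists (subg C y); rewrite ?inL ?subgK //; apply/tw_in12; rewrite subgK.
  have [By _] := setIP (sK2 _ Kx).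
  have Kay : al (sgval y) \in K1 by rewrite eK imset_f.
  have [Bay _] := setIP (sK1 _ Kay).
  by exists (subg B (al (sgval y))); rewrite ?inL ?subgK //; apply/esym/tw_in12; rewrite subgK.
have K12 x : x \in K1 -> exists2 y, y \in K2 & sgval y \in B /\ sgval x = al (sgval y).
  move=> Kx; have : tw_in1 x \in sg_in tw2 @: K2 by rewrite -eK imset_f.
  by case/imsetP=> y Ky /tw_in12; exists y.
have K21 y : y \in K2 -> exists2 x, x \in K1 & sgval y \in B /\ sgval x = al (sgval y).
  move=> Ky; have : tw_in2 y \in sg_in tw1 @: K1 by rewrite eK imset_f.
  by case/imsetP=> x Kx /esym/tw_in12; exists x.
have nJ (G : {group gT}) (K : {group subg_of G}) : K <| [set: subg_of G] -> G \subset 'N(sgval @: K).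
  move=> /andP[_ /subsetP nK]; apply/subsetP=> g Gg; rewrite inE.
  apply/subsetP=> _ /imsetP[_ /imsetP[x Kx ->] ->]; apply/imsetP; exists (x ^ subg G g).
    by rewrite memJ_norm // nK ?inE.
  by rewrite !conjgE /= subgK.
have imE (G : {group gT}) (K : {group subg_of G}) : sgval @* K = sgval @: K.
  by rewrite morphimEsub ?subsetT.
have L1_1 : (sgval @* K1)%G :=: 1.
  apply: (core _ (sgval @* K2)%G); rewrite /= ?imE ?nJ //.
  - apply/subsetP=> _ /imsetP[x Kx ->]; have [y Ky [By ->]] := K12 x Kx.
    by case: aut_al => _ _; apply; rewrite inE By subgP.
  - apply/subsetP=> _ /imsetP[y Ky ->]; have [_ _ [By _]] := K21 y Ky.
    by rewrite inE By subgP.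
  apply/setP=> z; apply/imsetP/imsetP => [[x Kx ->]|[_ /imsetP[y Ky ->] ->]].
    by have [y Ky [_ ->]] := K12 x Kx; exists (sgval y); rewrite ?imset_f.
  by have [x Kx [_ <-]] := K21 y Ky; exists x.
apply/trivgP/subsetP=> x Kx; have : sgval x \in sgval @* K1 by rewrite imE imset_f.
by rewrite L1_1 !inE => /eqP e; apply/eqP/subg_inj.
Qed.
End TwistedAmalgam.

(** * Amalgams of a given type and their gluing automorphisms *)

Section Classification.
Variables (gT : finGroupType) (B C : {group gT}).
Let I := (B :&: C)%G.

Lemma iso_mappingE (hT : finGroupType) (G : {group gT}) (J : {set hT}) (K : {set subg_of G}) :
  iso_mapping J K -> exists f : hT -> gT,
    [/\ {morph f : x y / x * y}, injective f, f @: [set: hT] = G &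
      forall x, (x \in J) = (f x \in sgval @: K)].
Proof.
move=> [f [/isomP[inj_f imf] fJ]]; have injf : injective f.
  by move=> x y; apply: (injmP inj_f); rewrite inE.
exists (fun x => sgval (f x)); split.
- by move=> x y; rewrite morphM ?inE.
- by move=> x y /subg_inj/injf.
- apply/setP=> z; apply/imsetP/idP => [[x _ ->]|Gz]; first exact: subgP.
  have : subg G z \in f @* setT by rewrite imf inE.
  by case/morphimP=> x _ _ e; exists x => //; rewrite -e subgK.
move=> x; rewrite -fJ; apply/idP/imsetP => [Jx|[_ /imsetP[y Jy ->] /subg_inj/injf -> //]].
by exists (f x); rewrite ?imset_f.
Qed.

(** Identifying the two groups of M with B and C identifies their intersection with I in two ways;
    comparing these gives [al]. Only the class of [al] modulo inner automorphisms matters, since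
    conjugation by h in I extends to B. *)
Lemma same_type_glueing M : same_type M (subgroup_amalgam B C) ->
  exists al, autG I al /\ forall al' (aut' : autG I al') h, h \in I ->
    {in I, forall g, al g = al' g ^ h} -> amalgam_iso M (tw_amalgam aut').
Proof.
case=> /iso_mappingE[f1 [f1M f1I f1T f1J]] /iso_mappingE[f2 [f2M f2I f2T f2J]].
have f1B x : f1 x \in B by rewrite -f1T imset_f ?inE.
have f2C x : f2 x \in C by rewrite -f2T imset_f ?inE.
have surj1 y : y \in B -> exists x, f1 x = y by rewrite -f1T => /imsetP[x _ ->]; exists x.
have surj2 y : y \in C -> exists x, f2 x = y by rewrite -f2T => /imsetP[x _ ->]; exists x.
have int1 x : (x \in inter1 M) = (f1 x \in C).
  rewrite f1J; apply/imsetP/idP => [[z + ->]|Cx].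
    by rewrite inE gset_subgroup_in.
  by exists (subg B (f1 x)); rewrite ?inE ?gset_subgroup_in /= subgK ?f1B.
have int2 x : (x \in inter2 M) = (f2 x \in B).
  rewrite f2J; apply/imsetP/idP => [[z + ->]|Cx].
    by rewrite inE gset_subgroup_in.
  by exists (subg C (f2 x)); rewrite ?inE ?gset_subgroup_in /= subgK ?f2C.
have [al alE] : exists al : gT -> gT, forall x1 x2,
    sg_in (am1 M) x1 = sg_in (am2 M) x2 -> al (f2 x2) = f1 x1.
  (* Injectivity makes the pair found unique; the default 1 is reached only outside I. *)
  pose al g := if [pick x : sg_gT (am1 M) * sg_gT (am2 M) |
     (sg_in (am1 M) x.1 == sg_in (am2 M) x.2) && (f2 x.2 == g)] is Some x then f1 x.1 else 1.
  exists al => x1 x2 e12; rewrite /al; case: pickP => [[y1 y2] /= /andP[/eqP e /eqP/f2I e2]|].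
    by congr f1; apply: (@sg_inj _ (am1 M)); rewrite e e2.
  by move/(_ (x1, x2)); rewrite /= e12 !eqxx.
have glue g : g \in I -> exists x1 x2, [/\ sg_in (am1 M) x1 = sg_in (am2 M) x2, f2 x2 = g & al g = f1 x1].
  case/setIP=> Bg /surj2[x2 e2]; have : x2 \in inter2 M by rewrite int2 e2.
  rewrite inE => /imsetP[x1 _ e]; exists x1, x2; split=> //; rewrite -e2; exact: alE.
have glueI x1 x2 : sg_in (am1 M) x1 = sg_in (am2 M) x2 -> f1 x1 \in I /\ f2 x2 \in I.
  move=> e; rewrite !inE f1B f2C -int1 -int2 !andbT !inE /=.
  by split; apply/imsetP; [exists x2 | exists x1].
have aut_al : autG I al.
  split=> [g h Ig Ih|g h Ig Ih|g Ig].
  - have [x1 [x2 [e <- ->]]] := glue _ Ig; have [y1 [y2 [e' <- ->]]] := glue _ Ih.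
    by rewrite -f1M -f2M; apply: alE; apply: am_agree.
  - have [x1 [x2 [e <- ->]]] := glue _ Ig; have [y1 [y2 [e' <- ->]]] := glue _ Ih.
    move/f1I => e1; congr f2; apply: (@sg_inj _ (am2 M)); by rewrite -e -e' e1.
  have [x1 [x2 [e _ ->]]] := glue _ Ig; by case: (glueI _ _ e).
exists al; split=> // al' aut' h Ih alE'.
have [Bh Ch] := setIP Ih.
(* The conjugation by h is absorbed into the identification with B. *)
pose k1 (x : sg_gT (am1 M)) : subg_of B := subg B (f1 x ^ h^-1).
pose k2 (x : sg_gT (am2 M)) : subg_of C := subg C (f2 x).
have k1E x : sgval (k1 x) = f1 x ^ h^-1 by rewrite subgK // groupJ ?groupV.
have k2E x : sgval (k2 x) = f2 x by rewrite subgK.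
have inj_surj_bij (P Q : finType) (f : P -> Q) : injective f -> (forall y, exists x, f x = y) -> bijective f.
  move=> finj fsurj; have [g gE] := fin_all_exists fsurj.
  by exists g => // x; apply: finj.
apply: (@amalgam_isoI M (tw_amalgam aut') k1 k2).
- split; last by move=> x y; apply: subg_inj; rewrite /= !k1E f1M conjMg.
  apply: inj_surj_bij => [x y|y].
    by move/(congr1 sgval); rewrite !k1E => /conjg_inj/f1I.
  have [|x e] := surj1 (sgval y ^ h); first by rewrite groupJ // subgP.
  by exists x; apply: subg_inj; rewrite k1E e conjgK.
- split; last by move=> x y; apply: subg_inj; rewrite /= !k2E f2M.
  apply: inj_surj_bij => [x y|y].
    by move/(congr1 sgval); rewrite !k2E => /f2I.
  have [x e] := surj2 _ (subgP y); by exists x; apply: subg_inj; rewrite k2E e.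
move=> x1 x2; split=> [e|/tw_in12[]].
  apply/tw_in12; rewrite k1E k2E; have [I1 I2] := glueI _ _ e; have [B2 _] := setIP I2.
  by split=> //; rewrite -(alE _ _ e) alE' // conjgK.
rewrite k1E k2E => B2 e; have I2 : f2 x2 \in I by rewrite inE B2 f2C.
have [y1 [y2 [e' /f2I ey2 ey]]] := glue _ I2; rewrite ey2 in e'; rewrite -e'.
by congr (sg_in (am1 M) _); apply: f1I; rewrite -ey alE' // -e conjgKV.
Qed.

(** An isomorphism places [al] and [al'] in one double coset of the automorphisms of I induced from
    B and from C. *)
Lemma tw_iso_aut al al' (aut : autG I al) (aut' : autG I al') :
  amalgam_iso (tw_amalgam aut) (tw_amalgam aut') ->
  exists be ga, [/\ autG B be, autG C ga, {in I, forall g, be g \in I}, {in I, forall g, ga g \in I} &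
    {in I, forall g, be (al g) = al' (ga g)}].
Proof.
case/amalgam_isoE=> f1 [f2 [[bij1 f1M] [bij2 f2M] f12]].
pose be g := sgval (f1 (subg B g)); pose ga g := sgval (f2 (subg C g)).
have aux (G : {group gT}) (f : subg_of G -> subg_of G) : bijective f ->
    {morph f : x y / x * y} -> autG G (fun g => sgval (f (subg G g))).
  move=> bijf fM; split=> [x y Gx Gy|x y Gx Gy|x Gx]; last exact: subgP.
    by rewrite subgM // fM.
  by move/subg_inj/(bij_inj bijf)/(congr1 sgval); rewrite !subgK.
have autB : autG B be by apply: aux.
have autC : autG C ga by apply: aux.
have key g : g \in I -> ga g \in B /\ be (al g) = al' (ga g).
  move=> Ig; have [Bg Cg] := setIP Ig; have Ialg : al g \in I by case: (aut) => _ _; apply.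
  have [Balg _] := setIP Ialg.
  have : tw_in1 (f1 (subg B (al g))) = tw_in2 B al' (f2 (subg C g)).
    by apply/(f12 (subg B (al g)) (subg C g))/tw_in12; rewrite !subgK.
  by case/tw_in12.
have gaI g : g \in I -> ga g \in I.
  by move=> Ig; have [Bg _] := key g Ig; rewrite inE Bg subgP.
exists be, ga; split=> //; last by move=> g /key[].
move=> g Ig; have [g' Ig' <-] := autG_surj aut Ig; have [_ ->] := key g' Ig'.
by case: (aut') => _ _; apply; apply: gaI.
Qed.
End Classification.

(** * The stabilisers B and C and their intersection I *)

Section Parabolics.
Variable n : nat.
Local Notation V := 'rV['F_2]_n.
Local Notation P := {perm V}.
Implicit Types (x y u v w k f : V) (g h : P) (S : {set V}) (c : bool) (s : seq V).
Local Notation "x + y" := (GRing.add x y).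
Local Notation "0" := (GRing.zero).

Lemma span1P v x : x \in spn [:: v] -> exists c, x = sc c v.
Proof.
rewrite /= !inE addv_eq0 => /orP[/eqP->|/eqP->]; first by exists false.
by exists true.
Qed.

Variables a b : V.
Hypotheses (nza : a != 0) (nzb : b != 0) (neq_ab : a != b).

Definition W := spn [:: a; b].
Definition grpB : {group P} := 'N_(AGL n)(<[tr a]>)%G.
Definition grpC : {group P} := 'N_(AGL n)(<<[set tr a; tr b]>>)%G.
Definition grpI : {group P} := (grpB :&: grpC)%G.

Lemma WP x : reflect (exists c d, x = sc c a + sc d b) (x \in W).
Proof.
rewrite /W /= !inE !addv_eq0 addv_eq; apply: (iffP idP) => [|[[] [[] ->]]] /=; last 4 first.
- by rewrite (GRing.addrC a) eqxx !orbT.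
- by rewrite GRing.addr0 eqxx orbT.
- by rewrite GRing.add0r eqxx !orbT.
- by rewrite GRing.addr0 eqxx.
case/orP => /orP[] /eqP->.
- by exists false, false; rewrite GRing.addr0.
- by exists false, true; rewrite GRing.add0r.
- by exists true, false; rewrite GRing.addr0.
by exists true, true; rewrite GRing.addrC.
Qed.

Lemma W0 : 0 \in W. Proof. by case: (span_closed [:: a; b]). Qed.
Lemma WD : {in W &, forall x y, x + y \in W}. Proof. by case: (span_closed [:: a; b]). Qed.
Lemma Wa : a \in W. Proof. by rewrite mem_span ?inE ?eqxx. Qed.
Lemma Wb : b \in W. Proof. by rewrite mem_span ?inE ?eqxx ?orbT. Qed.
Lemma Wsc c x : x \in W -> sc c x \in W.
Proof. by case: c => //= _; apply: W0. Qed.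
Lemma WDr x y : y \in W -> (x + y \in W) = (x \in W).
Proof. by move=> Wy; apply/idP/idP => Wx; [rewrite -(addvK x y) WD | rewrite WD]. Qed.
Lemma WDl x y : x \in W -> (x + y \in W) = (y \in W).
Proof. by rewrite GRing.addrC; apply: WDr. Qed.
Lemma span_cons v s x : (x \in spn (v :: s)) = (x \in spn s) || (x + v \in spn s).
Proof. by rewrite inE. Qed.
Lemma W_lin g : affine g -> lin g a \in W -> lin g b \in W -> {in W, forall w, lin g w \in W}.
Proof.
by move=> ag ga gb _ /WP[c [d ->]]; rewrite linD // !lin_sc WD ?Wsc.
Qed.
Lemma sc_a_neq_b c : sc c a != b.
Proof. by case: c; rewrite //= eq_sym. Qed.
Lemma sc_inj (x : V) c d : x != 0 -> sc c x = sc d x -> c = d.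
Proof. by case: c d => [] [] //= /eqP + e; [move/(_ e) | move/(_ (esym e))]. Qed.

(** These functionals form the dual space of V/W. *)
Definition annW k := ~~ dot k a && ~~ dot k b.
Lemma annW_dot k w : annW k -> w \in W -> dot k w = false.
Proof.
by case/andP=> /negPf ka /negPf kb /WP[c [d ->]]; rewrite !vecE ka kb !andbF.
Qed.
Lemma annWD k l : annW k -> annW l -> annW (k + l).
Proof. by rewrite /annW !vecE => /andP[/negPf-> /negPf->] /andP[/negPf-> /negPf->]. Qed.
Lemma sepW x : x \notin W -> exists2 k, annW k & dot k x.
Proof.
by case/separation_span=> k; rewrite /= andbT => kW kx; exists k.
Qed.
Lemma sepW1 u x : x \notin W -> x + u \notin W ->
  exists k, [/\ annW k, dot k u = false & dot k x].
Proof.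
move=> xW xuW; have: x \notin spn [:: u; a; b] by rewrite span_cons negb_or xW.
by case/separation_span=> k /= /and4P[/negPf ku ka kb _] kx; exists k; rewrite /annW ka kb.
Qed.
(** A functional that separates x from x + y takes the same value at x and at y. *)
Lemma sepW2 x y : x \notin W -> y \notin W -> exists k, [/\ annW k, dot k x & dot k y].
Proof.
move=> xW yW; case: (@sepW1 (x + y) x) => //; first by rewrite addKv.
by move=> k [kW]; rewrite dotD => kxy kx; exists k; split=> //; move: kxy; rewrite kx; case: dot.
Qed.

Lemma grpBP g : reflect (affine g /\ lin g a = a) (g \in grpB).
Proof.
apply: (iffP setIP) => [[/AGLP ag /normP ga]|[ag ga]]; last first.
  by split; [apply/AGLP | apply/normP; rewrite -cycleJ trJ // ga].
split=> //; move: ga; rewrite -cycleJ trJ // => /setP/(_ (tr (lin g a))).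
rewrite cycle_id => /esym.
(* Translations are involutions, so only the parity of the exponent matters. *)
case/cycleP=> i /=; rewrite -(odd_double_half i) expgD -muln2 mulnC expgM expgS expg1 trM addxx tr0.
rewrite expg1n mulg1; case: (odd i) => [/tr_inj //|/=]; rewrite expg0 -tr0 => /tr_inj.
by move/eqP; rewrite -(lin0 g) (inj_eq (@lin_inj _ g)) (negPf nza).
Qed.

Lemma gen_tr : <<[set tr a; tr b]>> = [set tr w | w in W].
Proof.
apply/eqP; rewrite eqEsubset; apply/andP; split; last first.
  apply/subsetP=> _ /imsetP[w /WP[c [d ->]] ->]; rewrite -trM.
  have ta : tr a \in <<[set tr a; tr b]>> by rewrite mem_gen ?inE ?eqxx.
  have tb : tr b \in <<[set tr a; tr b]>> by rewrite mem_gen ?inE ?eqxx ?orbT.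
  by rewrite groupM //; [case: c | case: d]; rewrite //= tr0 group1.
have gW : group_set [set tr w | w in W].
  apply/group_setP; split=> [|_ _ /imsetP[v Wv ->] /imsetP[w Ww ->]].
    by apply/imsetP; exists 0; rewrite ?W0 ?tr0.
  by rewrite trM imset_f // WD.
suff : <<[set tr a; tr b]>> \subset Group gW by []; rewrite gen_subG.
by apply/subsetP=> x; rewrite !inE => /orP[]/eqP->; rewrite imset_f ?Wa ?Wb.
Qed.

Lemma grpCP g : reflect (affine g /\ {in W, forall w, lin g w \in W}) (g \in grpC).
Proof.
apply: (iffP setIP) => [[/AGLP ag]|[ag gW]].
  rewrite gen_tr => /normP nW; split=> // w Ww.
  have : tr w ^ g \in [set tr w | w in W] by rewrite -nW memJ_conjg imset_f.
  by rewrite trJ // => /imsetP[v Wv /tr_inj->].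
split; first exact/AGLP.
rewrite gen_tr inE; apply/subsetP=> _ /imsetP[_ /imsetP[w Ww ->] ->].
by rewrite trJ // imset_f ?gW.
Qed.

Lemma grpIP g : reflect [/\ affine g, lin g a = a & lin g b \in W] (g \in grpI).
Proof.
apply: (iffP setIP) => [[/grpBP[ag ga] /grpCP[_ gW]]|[ag ga gb]].
  by split=> //; rewrite gW ?Wb.
by split; [apply/grpBP | apply/grpCP; split=> //; apply: W_lin; rewrite ?ga ?Wa].
Qed.

Lemma grpI_aff g : g \in grpI -> affine g. Proof. by case/grpIP. Qed.
Lemma grpI_a g : g \in grpI -> lin g a = a. Proof. by case/grpIP. Qed.
Lemma grpI_W g w : g \in grpI -> w \in W -> lin g w \in W.
Proof. by case/setIP=> _ /grpCP[_]; apply. Qed.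
Lemma grpI_notW g x : g \in grpI -> x \notin W -> lin g x \notin W.
Proof.
move=> Ig; apply: contra => /(grpI_W (groupVr Ig)).
by rewrite linKV //; apply: grpI_aff.
Qed.
Lemma grpI_b g : g \in grpI -> exists c, lin g b = b + sc c a.
Proof.
move=> Ig; have /WP[c [[] e]] := grpI_W Ig Wb; first by exists c; rewrite e GRing.addrC.
case: c e => /= e; rewrite GRing.addr0 in e.
  by move: neq_ab; rewrite -(inj_eq (@lin_inj _ g)) (grpI_a Ig) e eqxx.
by move: nzb; rewrite -(inj_eq (@lin_inj _ g)) e lin0 eqxx.
Qed.
Lemma grpI_Wmod g w : g \in grpI -> w \in W -> exists c, lin g w = w + sc c a.
Proof.
move=> Ig /WP[c [d ->]]; have [e ge] := grpI_b Ig.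
exists (d && e); rewrite linD ?lin_sc ?(grpI_a Ig) ?ge; last exact: grpI_aff.
by vec_eq.
Qed.

Lemma tr_I v : tr v \in grpI.
Proof. by apply/grpIP; rewrite !lin_tr Wb; split=> //; apply: tr_affine. Qed.
Lemma tv_I k u : dot k a = false -> dot k u = false -> (dot k b -> u \in W) -> tv k u \in grpI.
Proof.
move=> ka ku kb; apply/grpIP; rewrite !lin_tv !tvE // ka GRing.addr0.
split=> //; first exact: tv_affine.
by rewrite WDl ?Wb //; case: (dot k b) kb => [/(_ isT)|_] //; rewrite W0.
Qed.
Lemma tvW_I k u : annW k -> dot k u = false -> tv k u \in grpI.
Proof. by case/andP=> /negPf ka /negPf kb ku; rewrite tv_I ?kb. Qed.

(** Axis and centre are transported by the linear part of g; the extra translation appears when the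
    transported fixed hyperplane misses the origin. *)
Lemma conj_tv k u g : affine g -> dot k u = false ->
  exists l, [/\ forall x, dot l (lin g x) = dot k x, dot l (lin g u) = false
     & tv k u ^ g = tv l (lin g u) * tr (sc (dot l (g 0)) (lin g u))].
Proof.
move=> ag ku; have [l lE] : exists l, (fun x => dot k (lin g^-1 x)) =1 dot l.
  by apply: functional_dot => x y; rewrite linD ?dotD //; apply: affineV.
have lgE x : dot l (lin g x) = dot k x by rewrite -lE linKV.
exists l; split=> //; first by rewrite lgE.
apply/permP=> x; rewrite -(permKV g x) permM permJ; set y := g^-1 x.
have lgy : dot l (g y) = dot k y (+) dot l (g 0) by rewrite (linE g y) dotD lgE.
rewrite trE (tvE y) // (tvE (g y)) ?lgE // lgy GRing.addrC affE // lin_sc.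
by vec_eq.
Qed.

(** * The image of the translation group under an automorphism of I *)

Section Automorphism.
Variable al : P -> P.
Hypothesis aut_al : autG grpI al.
Hypothesis n_gt3 : (3 < n)%N.
Let alI g : g \in grpI -> al g \in grpI. Proof. by case: aut_al => _ _; apply. Qed.
Let alM g h : g \in grpI -> h \in grpI -> al (g * h) = al g * al h.
Proof. by case: aut_al => + _ _; apply. Qed.
Let al_inj g h : g \in grpI -> h \in grpI -> al g = al h -> g = h.
Proof. by case: aut_al => _ + _; apply. Qed.

(** Commuting with all translations makes the linear part trivial; the translation vector must then
    be fixed by every [tv k a] with k(a) = 0, which leaves only multiples of a. *)
Lemma central_I g : g \in grpI -> {in grpI, forall h, commute g h} -> exists c, g = tr (sc c a).
Proof.
move=> Ig cg; have ag := grpI_aff Ig.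
have g1 : lin g =1 id.
  move=> v; apply/tr_inj; rewrite -trJ //; apply/conjg_fixP/commgP.
  by apply/commute_sym/cg/tr_I.
have gE := lin_trP ag g1; move: (g 0) gE => c gE; rewrite gE.
have [/span1P[d ->]|/separation_span[k /= /andP[/negPf ka _] kc]] := boolP (c \in spn [:: a]).
  by exists d.
have Ik : tv k a \in grpI by rewrite tv_I // => _; apply: Wa.
have /commgP/conjg_fixP := cg _ Ik; rewrite gE trJ ?lin_tv ?tvE //; last exact: tv_affine.
by move=> /tr_inj/eqP; rewrite kc addv_id (negPf nza).
Qed.

Lemma al_tra : al (tr a) = tr a.
Proof.
have [|h Ih|c e] := @central_I (al (tr a)); first exact/alI/tr_I.
  have [h' Ih' <-] := autG_surj aut_al Ih.
  rewrite /commute -!alM ?tr_I //; congr (al _).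
  apply/commgP/conjg_fixP; rewrite trJ ?(grpI_a Ih') //; exact: grpI_aff.
case: c e => //=; rewrite tr0 -(autG1 aut_al) => /al_inj.
by move/(_ (tr_I a) (group1 _)); rewrite -tr0 => /tr_inj/eqP; rewrite (negPf nza).
Qed.

(** Modulo [tr a], g commutes with translations, so its linear part is x -> x + k(x) a. If k(u) = 1,
    conjugation by [tv l u], with l nonzero and vanishing on u and W, changes this linear part; n >
    3 provides l. Once g is a translation, transvections with centre b force it into W. *)
Lemma second_center_I g : g \in grpI ->
  {in grpI, forall h, exists c, g ^ h = g * tr (sc c a)} -> exists2 w, w \in W & g = tr w.
Proof.
move=> Ig cg; have ag := grpI_aff Ig.
have linW v : exists c, lin g v = v + sc c a.
  have [c e] := cg _ (tr_I v); exists c; move/permP/(_ v): e.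
  rewrite conjgE !permM trV !trE addxx lin_def => e; rewrite -(addvK (g 0) v) e; vec_eq.
have [k kE] : exists k, (fun v => lin g v != v) =1 dot k.
  apply: functional_dot => x y; rewrite linD //.
  have [[c ->] [d ->]] := (linW x, linW y).
  by rewrite GRing.addrACA scD !addv_id !sc_eq0 // !negbK.
have {linW kE} gE v : lin g v = v + sc (dot k v) a.
  by have [c e] := linW v; rewrite -kE e addv_id sc_eq0 // negbK.
have k0 : k = 0.
  apply/eqP/negPn/negP => /dot_neq0[u ku].
  have [l /= /and4P[/negPf lu la lb _] nzl] := @annihilator n [:: u; a; b] n_gt3.
  have Wl : annW l by rewrite /annW la.
  have Ih : tv l u \in grpI by apply: tvW_I.
  have [c gh] := cg _ Ih; have [x lx] := dot_neq0 nzl.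
  have := congr1 (fun t => lin t x) (congr1 (fun t => tv l u * t) gh).
  have ah := tv_affine l u; have at_ := tr_affine (sc c a).
  rewrite -conjgC !linM //; last exact: affineM.
  rewrite lin_tr !gE !lin_tv !tvE // !vecE lx ku (negPf la) /= => /eqP.
  by rewrite -addv_eq0 (_ : _ + _ = a) ?(negPf nza) //; vec_eq.
have g1 : lin g =1 id by move=> v; rewrite gE k0 dot0l GRing.addr0.
have gT := lin_trP ag g1; move: (g 0) gT => v gT; exists v => //.
apply/negPn/negP => /sepW[l Wl lv].
have lb : dot l b = false by rewrite (annW_dot Wl) ?Wb.
have Ih : tv l b \in grpI by apply: tvW_I.
have [c] := cg _ Ih; rewrite gT trJ ?lin_tv; last exact: tv_affine.
rewrite trM tvE // lv /= => /tr_inj /GRing.addrI/eqP; rewrite eq_sym.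
by rewrite (negPf (sc_a_neq_b c)).
Qed.

Lemma al_trsc c : al (tr (sc c a)) = tr (sc c a).
Proof. by case: c; rewrite /= ?al_tra // tr0 (autG1 aut_al). Qed.

Lemma al_trW w : w \in W -> exists2 w', w' \in W & al (tr w) = tr w'.
Proof.
move=> Ww; apply: second_center_I => [|h Ih]; first exact/alI/tr_I.
have [h' Ih' <-] := autG_surj aut_al Ih; have ah' := grpI_aff Ih'.
have [c hw] := grpI_Wmod Ih' Ww; exists c.
by rewrite -(autGJ aut_al) ?tr_I // trJ // hw -trM alM ?tr_I // al_trsc.
Qed.

Lemma al_trW_surj w : w \in W -> exists2 w', w' \in W & al (tr w') = tr w.
Proof.
move=> Ww; pose s v := al (tr v) 0.
have sE v : v \in W -> s v \in W /\ al (tr v) = tr (s v).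
  by case/al_trW=> v' Wv' e; rewrite /s e trE GRing.add0r.
have: w \in s @: W.
  suff -> : s @: W = W by [].
  apply/eqP; rewrite eqEcard card_in_imset ?leqnn ?andbT.
    by apply/subsetP=> _ /imsetP[v /sE[Wv _] ->].
  move=> v v' /sE[_ e] /sE[_ e'] svv'; apply/tr_inj/al_inj; rewrite ?tr_I //.
  by rewrite e e' svv'.
by case/imsetP=> v Wv ->; exists v => //; case: (sE v).
Qed.

(** V centralises the translations by W, and [al] permutes the latter. *)
Lemma al_tr_fixW v w : w \in W -> lin (al (tr v)) w = w.
Proof.
case/al_trW_surj=> w' Ww' e; apply: tr_inj; rewrite -trJ -?e; last exact/grpI_aff/alI/tr_I.
by rewrite -(autGJ aut_al) ?tr_I // trJ ?lin_tr //; apply: tr_affine.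
Qed.

Lemma al_tr_comm v v' : commute (al (tr v)) (al (tr v')).
Proof. by rewrite /commute -!alM ?tr_I // !trM GRing.addrC. Qed.

Lemma al_trJ v h : h \in grpI -> exists v', al (tr v) ^ h = al (tr v').
Proof.
move=> Ih; have [h' Ih' <-] := autG_surj aut_al Ih.
by exists (lin h' v); rewrite -(autGJ aut_al) ?tr_I // trJ //; apply: grpI_aff.
Qed.

(** V is its own centraliser in I, and this passes to its image under [al]. *)
Lemma al_tr_cent g : g \in grpI -> (forall v, commute g (al (tr v))) -> exists v, g = al (tr v).
Proof.
move=> Ig cg; have [g' Ig' e] := autG_surj aut_al Ig; have ag' := grpI_aff Ig'.
exists (g' 0); rewrite -(lin_trP ag') // => v; apply/tr_inj; rewrite -trJ //.
apply: al_inj; rewrite ?groupJ ?tr_I //; rewrite (autGJ aut_al) ?tr_I // e.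
exact/conjg_fixP/commgP/commute_sym/cg.
Qed.

Lemma al_tr_mul v v' : al (tr v) * al (tr v') = al (tr (v + v')).
Proof. by rewrite -alM ?tr_I // trM. Qed.

Lemma al_tr_invol v x : al (tr v) (al (tr v) x) = x.
Proof. by rewrite -permM al_tr_mul addxx tr0 (autG1 aut_al) perm1. Qed.

Lemma al_tr_linK v x : lin (al (tr v)) (lin (al (tr v)) x) = x.
Proof.
rewrite -linM; last exact/grpI_aff/alI/tr_I.
by rewrite al_tr_mul addxx tr0 (autG1 aut_al) lin1.
Qed.

(* Otherwise the transvection swapping x and its nontrivial displacement moves
   the involution al (tr v) to one with which it does not commute. *)
Lemma al_tr_modW v x : lin (al (tr v)) x + x \in W.
Proof.
set r := al (tr v); have Ir : r \in grpI by exact/alI/tr_I.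
have ar := grpI_aff Ir; apply/negPn/negP; set u := _ + x => uW.
have rx : lin r x = x + u by rewrite /u; vec_eq.
have ru : lin r u = u by rewrite linD // al_tr_linK GRing.addrC.
have xW : x \notin W.
  by apply: contra uW => Wx; rewrite /u al_tr_fixW // addxx W0.
have [k [kW kx ku]] := sepW2 xW uW.
have kxu : dot k (x + u) = false by rewrite dotD kx ku.
have Ih := tvW_I kW kxu; set h := tv k (x + u) in Ih.
have [v' rh] := al_trJ v Ih; rewrite -/r in rh.
have ah : affine h by apply: tv_affine.
have hE y : lin h y = y + sc (dot k y) (x + u) by rewrite lin_tv tvE.
have rhE y : lin (r ^ h) y = lin h (lin r (lin h y)).
  by rewrite conjgE tvV !linM //; apply: affineM.
have hx : lin h x = u by rewrite hE kx /=; vec_eq.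
have hu : lin h u = x by rewrite hE ku /=; vec_eq.
have := congr1 (fun t => lin t x) (al_tr_comm v v').
have arh : affine (r ^ h) by apply/grpI_aff; rewrite groupJ.
rewrite -rh -/r (linM _ _ arh) (linM _ _ ar) !rhE hx ru hu rx linD // hx hu linD // ru rx.
rewrite (_ : u + (x + u) = x) ?hx => [/eqP|]; last by vec_eq.
rewrite -addv_eq0 (_ : _ + _ = x); last by vec_eq.
by move/eqP=> x0; move: xW; rewrite x0 W0.
Qed.

Lemma grpI_annW g k : g \in grpI -> annW k -> exists2 l, annW l & forall x, dot l (lin g x) = dot k x.
Proof.
move=> Ig kW; have ag := grpI_aff Ig.
have [l [lE _ _]] := conj_tv ag (dot0 k); exists l => //.
by rewrite /annW -(linVK a ag) -(linVK b ag) !lE !(annW_dot kW) ?(grpI_W (groupVr Ig)) ?Wa ?Wb.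
Qed.

(** Since n > 3, V/W has dimension at least two; k and l are dual to p and q there. *)
Lemma two_coords : exists p q k l,
  [/\ p \notin W, q \notin W, p + q \notin W, annW k & annW l] /\
  [/\ dot k p, dot k q = false, dot l p = false & dot l q].
Proof.
have [p pW] : exists p, p \notin W by apply: span_proper; apply: leq_trans n_gt3.
have [q] : exists q, q \notin spn [:: p; a; b] by apply: span_proper.
rewrite span_cons negb_or -/(spn _) => /andP[qW qpW].
have [k [kW kq kp]] := @sepW1 q p pW ltac:(by rewrite GRing.addrC).
have [l [lW lp lq]] := @sepW1 p q qW qpW.
by exists p, q, k, l; rewrite GRing.addrC.
Qed.

(* All the [al (tr y)] with y outside W are conjugate in I, so each of them is, up to a
   translation in W, a transvection as well; then the product of two transvections with
   distinct axes and centres a and b centralises all of them. *)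
Lemma al_tr_neq_tv k w y : annW k -> k != 0 -> w \in W -> w != 0 -> al (tr y) <> tv k w.
Proof.
move=> kW nzk Ww nzw ey; have kw := annW_dot kW Ww.
have yW : y \notin W.
  apply/negP=> /al_trW[w' _]; rewrite ey => e; have [x kx] := dot_neq0 nzk.
  have := congr1 (fun g => lin g x) e; rewrite lin_tr lin_tv tvE // kx => /eqP.
  by rewrite addv_id (negPf nzw).
have shape z : exists l v w', [/\ annW l, v \in W, w' \in W &
    forall x, al (tr z) x = x + sc (dot l x) v + w'].
  case: (boolP (z \in W)) => [/al_trW[w' Ww' ->]|zW].
    exists 0, 0, w'; rewrite W0 /annW !dot0l; split=> // x.
    by rewrite trE dot0l GRing.addr0.
  have [l [lW ly lz]] := sepW2 yW zW.
  have lyz : dot l (y + z) = false by rewrite dotD ly lz.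
  have Ih := tvW_I lW lyz; have ah := grpI_aff Ih.
  have zE : tr z = tr y ^ tv l (y + z).
    by rewrite trJ // lin_tv tvE // ly addKv.
  have Ig := alI Ih; set g := al _ in Ig.
  have [k' [k'E k'w e]] := conj_tv (grpI_aff Ig) kw.
  exists k', (lin g w), (sc (dot k' (g 0)) (lin g w)).
  have Wgw := grpI_W Ig Ww; split; rewrite ?Wsc //.
    rewrite /annW -(linVK a (grpI_aff Ig)) -(linVK b (grpI_aff Ig)) !k'E.
    by rewrite !(annW_dot kW) ?(grpI_W (groupVr Ig)) ?Wa ?Wb.
  by move=> x; rewrite zE (autGJ aut_al) ?tr_I // ey -/g e permM tvE // trE.
have [p [q [l [m [[pW qW pqW lW mW] [lp lq mp mq]]]]]] := two_coords.
have [la lb] := (annW_dot lW Wa, annW_dot lW Wb).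
have [ma mb] := (annW_dot mW Wa, annW_dot mW Wb).
have [||z ez] := @al_tr_cent (tv l a * tv m b).
- by rewrite groupM ?tvW_I.
- move=> z; have [k' [v [w' [k'W Wv Ww' zE]]]] := shape z.
  apply/permP=> x; rewrite !permM !zE !tvE //.
  rewrite !vecE ?la ?lb ?ma ?mb !(annW_dot k'W Wa, annW_dot k'W Wb).
  rewrite !(annW_dot lW Wv, annW_dot lW Ww', annW_dot mW Wv, annW_dot mW Ww').
  by rewrite !andbF !addbF; vec_eq.
have [k' [v [w' [k'W Wv Ww' zE]]]] := shape z.
have fE x : x + sc (dot l x) a + sc (dot m x) b = x + sc (dot k' x) v + w'.
  rewrite -zE -ez permM !tvE // !vecE ma andbF addbF //.
have w'0 : w' = 0 by have := fE 0; rewrite !dot0 /= !GRing.addr0 GRing.add0r.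
have := fE q; have := fE p; rewrite lp lq mp mq w'0 /= !GRing.addr0.
case: (dot k' p) => /= [/GRing.addrI <-|/eqP]; last by rewrite GRing.addr0 addv_id (negPf nza).
by move/GRing.addrI/eqP; rewrite eq_sym (negPf (sc_a_neq_b _)).
Qed.

(** The image of V is normal in I, so it contains the product of r with its conjugate under
    [tv k u]. As r is an involution acting trivially modulo W and on W, this product is a
    transvection up to a translation. *)
Lemma al_tr_shift v u k : annW k -> dot k u = false ->
  let r := al (tr v) in let w := lin r u + u in
  exists y, al (tr y) = tv k w * tr (sc (dot k (r 0)) (u + w)).
Proof.
move=> kW ku /=; set r := al (tr v); set w := lin r u + u.
have Ir : r \in grpI by apply/alI/tr_I.
have ar := grpI_aff Ir; have Ww : w \in W by apply: al_tr_modW.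
have kw := annW_dot kW Ww; have Ih := tvW_I kW ku.
have [v' rh] := al_trJ v Ih; exists (v' + v); rewrite -al_tr_mul -rh -/r.
have ru : lin r u = u + w by rewrite /w; vec_eq.
have rw : lin r w = w by apply: al_tr_fixW.
have ruw : lin r (u + w) = u by rewrite linD // ru rw addvK.
have rr x : lin r (lin r x) = x by apply: al_tr_linK.
have kr x : dot k (lin r x) = dot k x.
  have := annW_dot kW (al_tr_modW v x); rewrite dotD -/r.
  by case: (dot k x); case: dot.
have rc : lin r (r 0) = r 0.
  by apply/eqP; rewrite -addv_eq0 -linE; apply/eqP/al_tr_invol.
have rE x : r x = lin r x + r 0 by apply: linE.
move: (r 0) rc rE => c rc rE; apply/permP=> x.
rewrite conjgE tvV !permM !(tvE _ ku) !(tvE _ kw) trE !rE.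
rewrite !(linD ar) !(lin_sc, linD ar) rr ?ru ?rc ?rw ?ruw ?vecE !kr ?vecE ?ku ?kw ?andbF ?addbF.
by vec_eq.
Qed.

Lemma al_tr_translation v x : (4 < n)%N -> lin (al (tr v)) x = x.
Proof.
move=> n_gt4; apply/eqP; rewrite -addv_eq0; apply/negPn/negP=> nzw.
pose c := al (tr v) 0.
(* With n > 4 the functional can also vanish at c, so the translation factor in [al_tr_shift]
   disappears and a pure transvection remains, against [al_tr_neq_tv]. *)
have [k /= /and5P[ka kb /negPf kx /negPf kc _] nzk] := @annihilator n [:: a; b; x; c] n_gt4.
have kW : annW k by rewrite /annW ka.
have [y] := al_tr_shift v kW kx; rewrite kc tr0 mulg1.
by apply: al_tr_neq_tv => //; apply: al_tr_modW.
Qed.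

(** By [al_tr_neq_tv] the translation factor in [al_tr_shift] is nontrivial; its W-part is removed
    by an element of al(W). If the centre w were not a, multiplying by a conjugate under some
    [tv l a] would leave the pure transvection [tv k a] up to [tr a]. *)
Lemma al_tr_nontranslation v x : lin (al (tr v)) x != x ->
  exists u y k, [/\ u \notin W, annW k, k != 0, dot k u = false & al (tr y) = tv k a * tr u].
Proof.
rewrite -addv_eq0 => nzw; set w := _ + x in nzw.
have Ww : w \in W by apply: al_tr_modW.
have xW : x \notin W by apply: contra nzw => Wx; rewrite /w al_tr_fixW // addxx.
have [k /= /and4P[/negPf kx ka kb _] nzk] := @annihilator n [:: x; a; b] n_gt3.
have kW : annW k by rewrite /annW ka.
have kw := annW_dot kW Ww; have ka0 := annW_dot kW Wa.
have [y0] := al_tr_shift v kW kx; rewrite -/w.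
case: (dot k _) => [/=|]; last by rewrite tr0 mulg1 => /al_tr_neq_tv [].
have [w' _ ew'] := al_trW_surj Ww.
rewrite -trM => e0; exists x.
have {y0 e0} [y ey] : exists y, al (tr y) = tv k w * tr x.
  by exists (y0 + w'); rewrite -al_tr_mul e0 ew' -mulgA -mulgA trM addxx tr0 mulg1.
clearbody w; have [wa|] := boolP (w \in spn [:: a]).
  exists y, k; split=> //; rewrite ey; case/span1P: wa nzw => [[]] -> //=.
  by rewrite eqxx.
case/separation_span=> l /= /andP[/negPf la _] lw.
have Ih : tv l a \in grpI by rewrite tv_I // => _; apply: Wa.
have [y' ey'] := al_trJ y Ih.
pose d := sc (dot l x) a.
have : al (tr (y + y' + d)) = tv k a.
  rewrite -!al_tr_mul -ey' ey al_trsc; apply/permP=> z.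
  rewrite conjgE tvV !permM !trE !tvE //.
  by rewrite !vecE lw la kw ka0 kx /=; vec_eq.
by move/al_tr_neq_tv; case=> //; apply: Wa.
Qed.

End Automorphism.

(** * Automorphisms fixing the translations *)

(** For an automorphism fixing all translations this is the derivation d with be(g) = g *
    tr(d(g)). *)
Definition disp (be : P -> P) g := be g 0 + g 0.

Section FixedTranslations.
Variables (G : {group P}) (be : P -> P).
Hypotheses (affG : {in G, forall g, affine g}) (trG : forall v, tr v \in G).
Hypotheses (aut_be : autG G be) (be_tr : forall v, be (tr v) = tr v).
Let d := disp be.

Lemma lin_fix g x : g \in G -> lin (be g) x = lin g x.
Proof.
move=> Gg; have Gbg : be g \in G by case: aut_be => _ _; apply.
have [ag abg] := (affG Gg, affG Gbg).
apply: tr_inj; rewrite -trJ // -{1}(be_tr x) -(autGJ aut_be) ?trG //.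
by rewrite trJ // be_tr.
Qed.

Lemma disp_fix g : g \in G -> be g = g * tr (d g).
Proof.
move=> Gg; rewrite /d /disp GRing.addrC; apply: lin_eq => x.
by rewrite lin_fix.
Qed.

Lemma dispM g h : g \in G -> h \in G -> d (g * h) = lin h (d g) + d h.
Proof.
move=> Gg Gh; have Gbh : be h \in G by case: aut_be => _ _; apply.
have abh := affG Gbh; rewrite {1}/d /disp; case: aut_be => -> // _ _; rewrite !permM.
rewrite -[be g 0](addvK _ (g 0)) affE // lin_fix //.
rewrite (linE (be h)) (linE h (g 0)) lin_fix //.
by rewrite -/(disp be g) -/d {3}/d /disp; vec_eq.
Qed.

Lemma disp_tr v : d (tr v) = 0.
Proof. by rewrite /d /disp be_tr addxx. Qed.

Lemma dispMtr g v : g \in G -> d (g * tr v) = d g.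
Proof. by move=> Gg; rewrite dispM // disp_tr lin_tr GRing.addr0. Qed.

(** Evaluating the derivation on both sides of g * t^g = t * g turns conjugacy relations into linear
    equations. *)
Lemma dispJ g t : g \in G -> t \in G -> lin (t ^ g) (d g) + d (t ^ g) = lin g (d t) + d g.
Proof.
by move=> Gg Gt; rewrite -!dispM ?groupJ // -conjgC.
Qed.

Lemma disp1 : d 1 = 0.
Proof. by rewrite -(tr0 n) disp_tr. Qed.

(** The correction term is the inner derivation defined by v. *)
Lemma disp_conj v g : g \in G -> disp (fun g => be g ^ tr v) g = d g + lin g v + v.
Proof.
move=> Gg; have Gbg : be g \in G by case: aut_be => _ _; apply.
rewrite /disp conjgE trV !permM !trE GRing.add0r (linE (be g)) lin_fix // /d /disp.
by vec_eq.
Qed.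
End FixedTranslations.

Lemma tvDl k l u : dot k u = false -> dot l u = false -> tv (k + l) u = tv k u * tv l u.
Proof.
move=> ku lu; apply/permP=> x; rewrite permM !tvE ?vecE ?ku ?lu //.
by rewrite andbF addbF; vec_eq.
Qed.

Lemma tvJ k l u w : dot l u = false -> dot k w = false -> dot l w = false ->
  tv k w ^ tv l u = tv (k + sc (dot k u) l) w.
Proof.
move=> lu kw lw; apply/permP=> x.
rewrite conjgE tvV !permM !tvE ?vecE ?kw ?lw ?lu ?andbF //.
by rewrite !addbF andbC; vec_eq.
Qed.

(** * Derivations on I modulo inner derivations *)

Section Cocycle.
Hypothesis n_gt3 : (3 < n)%N.
Let affI : {in grpI, forall g, affine g}. Proof. by move=> g /grpI_aff. Qed.

(** [tv k w] commutes with [tv l w'] for l in [annW] and w' in W. If l were 1 at the displacement,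
    the derivation of this relation would force w' to be 0 or w, but W has a further vector. *)
Lemma disp_tvW be k w : autG grpI be -> (forall v, be (tr v) = tr v) ->
  annW k -> w \in W -> disp be (tv k w) \in W.
Proof.
move=> aut_be be_tr kW Ww; apply/negPn/negP => /sepW[l lW ld].
have [w' [Ww' nzw' neq_w']] : exists w', [/\ w' \in W, w' != 0 & w' != w].
  have [wa|wa] := eqVneq w a; last by exists a; rewrite Wa nza eq_sym.
  by exists b; rewrite Wb nzb wa eq_sym.
have lw' := annW_dot lW Ww'; have kw' := annW_dot kW Ww'.
have kw := annW_dot kW Ww; have lw := annW_dot lW Ww.
have tc : tv k w * tv l w' = tv l w' * tv k w.
  apply/permP=> x; rewrite !permM !tvE // !vecE kw' lw !andbF !addbF.
  by vec_eq.
have Ik := tvW_I kW kw; have Il := tvW_I lW lw'.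
have := congr1 (disp be) tc; rewrite !(dispM affI tr_I) // !lin_tv !tvE // ld /= => /eqP.
rewrite -addv_eq0; set c := dot k _.
rewrite (_ : _ + _ = w' + sc c w); last by vec_eq.
by rewrite addv_eq0; case: c; rewrite /= ?(negPf nzw') ?(negPf neq_w').
Qed.

(* Comparing the displacements of tv f w and of its conjugate by tv k u, where f(u) = 1,
   expresses that of tv k w through a scalar that depends on tv k u only. *)
Lemma disp_tv_scalar be k : autG grpI be -> (forall v, be (tr v) = tr v) ->
  annW k -> exists e, {in W, forall w, disp be (tv k w) = sc e w}.
Proof.
move=> aut_be be_tr kW.
have [u uW ku] : exists2 u, u \notin W & dot k u = false.
  have [p [q [_ [_ [[pW qW pqW _ _] _]]]]] := two_coords n_gt3.
  case kp: (dot k p); last by exists p.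
  by case kq: (dot k q); [exists (p + q); rewrite ?dotD ?kp ?kq | exists q].
have [f fW fu] := sepW uW; have Ig := tvW_I kW ku.
exists (dot (f + k) (disp be (tv k u))) => w Ww.
have [fw kw] := (annW_dot fW Ww, annW_dot kW Ww).
have [If Ik] := (tvW_I fW fw, tvW_I kW kw).
have := dispJ affI tr_I aut_be be_tr Ig If; rewrite tvJ // fu /= tvDl //.
rewrite (dispM affI tr_I) // -tvDl // !lin_tv (tvE _ kw) tvE ?dotDl ?fw ?kw //.
have Wd := disp_tvW aut_be be_tr fW Ww; rewrite (annW_dot kW Wd).
rewrite (tvE _ ku) (annW_dot kW Wd) -dotDl /= !GRing.addr0 => /eqP.
rewrite -addv_eq0 => e; apply/eqP; rewrite -addv_eq0 -(eqP e); apply/eqP.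
by vec_eq.
Qed.

(** The scalars of [disp_tv_scalar] are additive in k, hence given by evaluation at a vector v. On
    these transvections the derivation is thus inner. *)
Lemma disp_tv_coboundary be : autG grpI be -> (forall v, be (tr v) = tr v) ->
  exists v, forall k w, annW k -> w \in W -> disp be (tv k w) = sc (dot k v) w.
Proof.
move=> aut_be be_tr; have dE := disp_tv_scalar aut_be be_tr.
have dD k l : annW k -> annW l -> disp be (tv (k + l) a) = disp be (tv k a) + disp be (tv l a).
  move=> kW lW; have [ka la] := (annW_dot kW Wa, annW_dot lW Wa).
  rewrite tvDl // (dispM affI tr_I) ?tvW_I //; have [e ->] := dE k kW; last exact: Wa.
  by rewrite lin_tv tvE // dot_sc la andbF /= GRing.addr0.
have d0 : disp be (tv 0 a) = 0.
  have -> : tv 0 a = 1 by apply/permP=> x; rewrite tvE ?dot0l // GRing.addr0 perm1.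
  by rewrite (disp1 be_tr).
(* S is the kernel of the scalar on [annW]; a vector separating it from some k0 outside it
   represents the scalar. *)
pose S := [set k | annW k && (disp be (tv k a) == 0)].
have SD : add_closed S.
  split=> [|k l]; rewrite !inE ?d0 ?eqxx ?andbT; first by rewrite /annW !dot0l.
  by move=> /andP[kW /eqP kd] /andP[lW /eqP ld]; rewrite annWD // dD // kd ld GRing.addr0 eqxx.
have [/forallP S_all|/forallPn[k0]] := boolP [forall k, annW k ==> (k \in S)].
  exists 0 => k w kW Ww; have := S_all k; rewrite kW inE /= dot0.
  case/andP=> _ /eqP; have [e dk] := dE k kW; rewrite !dk ?Wa // => /eqP.
  by rewrite sc_eq0 // => /negPf ->.
rewrite negb_imply => /andP[k0W k0S]; have [v vS vk0] := separation SD k0S.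
exists v => k w kW Ww; have [e dk] := dE k kW; rewrite dk //; congr (sc _ w).
have [e0 dk0] := dE k0 k0W; case: e0 dk0 => dk0; last first.
  by case/negP: k0S; rewrite inE k0W dk0 ?Wa /=.
case: e dk => dk; last first.
  by rewrite dotC vS // inE kW dk ?Wa /=.
have : k + k0 \in S by rewrite inE annWD //= dD // dk ?dk0 ?Wa //= addxx.
by move/vS; rewrite dotD vk0 dotC; case: dot.
Qed.

(** For k in [annW], both [tv k a] and its conjugate under the inverse of g have displacement zero,
    so by [dispJ] the transvection fixes d(g), that is, k(d(g)) = 0. *)
Lemma disp_in_W be : autG grpI be -> (forall v, be (tr v) = tr v) ->
  (forall k w, annW k -> w \in W -> disp be (tv k w) = 0) ->
  {in grpI, forall g, disp be g \in W}.
Proof.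
move=> aut_be be_tr dT g Ig; apply/negPn/negP=> /sepW[k kW kd].
have [ag ka] := (grpI_aff Ig, annW_dot kW Wa); have aVg := affineV ag.
have [l [lE la e]] := conj_tv aVg ka; have IgV := groupVr Ig.
have ga := grpI_a IgV; rewrite ga in la e.
have lW : annW l.
  by rewrite /annW -(linKV a ag) -(linKV b ag) !lE !(annW_dot kW) ?(grpI_W Ig) ?Wa ?Wb.
have Il := tvW_I lW la.
have := dispJ affI tr_I aut_be be_tr Ig (groupM Il (tr_I (sc (dot l (g^-1%g 0)) a))).
rewrite -e conjgKV dT ?Wa // e (dispMtr affI tr_I) // dT ?Wa // lin0 lin_tv tvE // kd /=.
by rewrite GRing.addr0 GRing.add0r => /eqP; rewrite addv_id (negPf nza).
Qed.

(** The argument of [disp_in_W], applied to an axis k0 that is 1 at b, confines the derivation to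
    multiples of a. Since I fixes a, it becomes a homomorphism to F_2. *)
Lemma disp_normalized be k0 : autG grpI be -> (forall v, be (tr v) = tr v) ->
  (forall k w, annW k -> w \in W -> disp be (tv k w) = 0) ->
  dot k0 a = false -> dot k0 b -> disp be (tv k0 a) = 0 ->
  exists de : P -> bool, [/\ {in grpI, forall g, be g = g * tr (sc (de g) a)},
     {in grpI &, forall g h, de (g * h) = de g (+) de h} &
     {in grpI, forall g, (forall x, lin g x + x \in W) -> de g = false}].
Proof.
move=> aut_be be_tr dT k0a k0b dk0; have dW := disp_in_W aut_be be_tr dT.
have Ie : tv k0 a \in grpI by rewrite tv_I // => _; apply: Wa.
have dg g : g \in grpI -> exists c, disp be g = sc c a.
  move=> Ig; have ag := grpI_aff Ig; have aVg := affineV ag; have IgV := groupVr Ig.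
  have [l [lE la e]] := conj_tv aVg k0a; have ga := grpI_a IgV; rewrite ga in la e.
  (* I acts trivially on W modulo a, so conjugation changes the axis k0 only by an element of
     [annW], and the conjugate also has displacement zero. *)
  have mW : annW (k0 + l).
    have [c gb] := grpI_b Ig; have lb : dot l b by rewrite -(linKV b ag) lE gb !vecE k0a k0b andbF.
    by rewrite /annW !dotDl k0a la k0b lb.
  have ma := annW_dot mW Wa.
  have lE' : l = k0 + (k0 + l) by rewrite addKv.
  have Il : tv l a \in grpI by rewrite lE' tvDl // groupM // tvW_I.
  have dl : disp be (tv l a) = 0.
    by rewrite lE' tvDl // (dispM affI tr_I) ?Ie ?tvW_I // dk0 lin0 dT ?Wa ?GRing.addr0.
  have := dispJ affI tr_I aut_be be_tr Ig (groupM Il (tr_I (sc (dot l (g^-1%g 0)) a))).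
  rewrite -e conjgKV dk0 e (dispMtr affI tr_I) // dl lin0 lin_tv tvE //.
  rewrite GRing.addr0 GRing.add0r => /eqP; rewrite addv_id sc_eq0 //.
  have /WP[c [[] ->]] := dW g Ig; rewrite !vecE ?k0a ?k0b ?andbF //= => _.
  by exists c; rewrite GRing.addr0.
pose de g := disp be g != 0.
have deE g : g \in grpI -> disp be g = sc (de g) a.
  by case/dg=> c e; rewrite /de e sc_eq0 // negbK.
have deM : {in grpI &, forall g h, de (g * h) = de g (+) de h}.
  move=> g h Ig Ih; apply: (@sc_inj a) => //.
  rewrite -deE ?groupM // (dispM affI tr_I) // !deE // lin_sc (grpI_a Ih).
  exact: scD.
exists de; split=> //.
  by move=> g Ig; rewrite -deE //; apply: (disp_fix affI tr_I).
have de_tv k w : annW k -> w \in W -> de (tv k w) = false by move=> *; rewrite /de dT ?eqxx.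
have fix_b g : g \in grpI -> lin g b = b -> (forall x, lin g x + x \in W) -> de g = false.
  move=> Ig gb gW; have ag := grpI_aff Ig; have ga := grpI_a Ig.
  (* On W, [ka] and [k0] are the coordinates for the basis a, b. Applied to the displacement of x
     under [lin g] they give functionals k1 and k2, so g is [tv k1 a * tv k2 b] up to a
     translation. *)
  have [ka kaa kab] : exists2 k, dot k a & dot k b = false.
    have: a \notin spn [:: b].
      by apply/negP=> /span1P[[] /eqP]; rewrite ?(negPf neq_ab) ?(negPf nza).
    by case/separation_span=> k /= /andP[/negPf]; exists k.
  have fD k : {morph (fun x => dot k (lin g x + x)) : x y / x + y >-> x (+) y}.
    by move=> x y; rewrite linD // !dotD; bool_cases.
  have [[k1 k1E] [k2 k2E]] := (functional_dot (fD ka), functional_dot (fD k0)).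
  have [k1W k2W] : annW k1 /\ annW k2 by rewrite /annW -!k1E -!k2E ga gb !addxx !dot0.
  have [k1a k2b] := (annW_dot k1W Wa, annW_dot k2W Wb).
  have -> : g = tv k1 a * tv k2 b * tr (g 0).
    apply/permP=> x; rewrite !permM trE !tvE //.
    rewrite dotD dot_sc (annW_dot k2W Wa) andbF addbF -k1E -k2E linE.
    have /WP[c [e gx]] := gW x; rewrite gx !vecE k0a k0b kaa kab !andbF !andbT addbF /=.
    have -> : lin g x = x + (sc c a + sc e b) by rewrite -gx; vec_eq.
    by vec_eq.
  by rewrite !deM ?groupM ?tvW_I ?tr_I // !de_tv ?Wa ?Wb // /de (disp_tr be_tr) eqxx.
move=> g Ig gW; have [[] gb] := grpI_b Ig; last first.
  by apply: fix_b; rewrite ?gb ?GRing.addr0.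
(* Here g sends b to b + a, and composing with [tv k0 a] restores b. *)
have : de (g * tv k0 a) = false.
  have ae := tv_affine k0 a.
  apply: fix_b => [||x]; rewrite ?groupM // linM // lin_tv tvE //.
    by rewrite gb dotD /= k0a k0b; vec_eq.
  by rewrite GRing.addrAC WDr ?Wsc ?Wa.
by rewrite deM // {2}/de dk0 eqxx addbF.
Qed.

(** Two inner corrections normalise the derivation: the first kills it on the [tv k w] with k in
    [annW], the second, along b, on [tv k0 a]. *)
Lemma fixed_translations_disp be : autG grpI be -> (forall v, be (tr v) = tr v) ->
  exists z (de : P -> bool), [/\ {in grpI, forall g, be g ^ tr z = g * tr (sc (de g) a)},
     {in grpI &, forall g h, de (g * h) = de g (+) de h} &
     {in grpI, forall g, (forall x, lin g x + x \in W) -> de g = false}].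
Proof.
move=> aut_be be_tr.
have [k0 /= /andP[/negPf k0a _] k0b] : exists2 k, all (fun y => ~~ dot k y) [:: a] & dot k b.
  apply: separation_span; apply/negP=> /span1P[c /esym/eqP].
  by rewrite (negPf (sc_a_neq_b c)).
have Ie : tv k0 a \in grpI by rewrite tv_I // => _; apply: Wa.
have cj v : autG grpI (fun g => be g ^ tr v) by apply: autG_comp (autG_conj (tr_I v)) aut_be.
have cjtr v w : be (tr w) ^ tr v = tr w.
  by rewrite be_tr trJ ?lin_tr //; apply: tr_affine.
have [v dv] := disp_tv_coboundary aut_be be_tr.
pose be1 g := be g ^ tr v; have [aut1 tr1] := (cj v, cjtr v).
have d1 k w : annW k -> w \in W -> disp be1 (tv k w) = 0.
  move=> kW Ww; have kw := annW_dot kW Ww.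
  rewrite (disp_conj affI tr_I aut_be be_tr) ?tvW_I // dv // lin_tv tvE //.
  by vec_eq.
(* The derivation law for the involution [tv k0 a] makes k0 vanish on its displacement, which lies
   in W. *)
have [c dc] : exists c, disp be1 (tv k0 a) = sc c a.
  have ee : tv k0 a * tv k0 a = 1 by apply/permP=> x; rewrite permM tv_invK perm1.
  have := dispM affI tr_I aut1 tr1 Ie Ie; rewrite -/be1 ee (disp1 tr1) lin_tv tvE //.
  move=> /esym/eqP; have := disp_in_W aut1 tr1 d1 Ie.
  rewrite -/be1; set e := disp _ _ => We.
  rewrite (_ : e + _ + e = sc (dot k0 e) a); last by vec_eq.
  rewrite sc_eq0 //; case/WP: We => c [[] ->]; rewrite !vecE ?k0a ?k0b ?andbF //= => _.
  by exists c; rewrite GRing.addr0.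
(* Conjugation by [tr b] adds a to the displacement of [tv k0 a], as k0(b) = 1, and does not affect
   the [tv k w], as k(b) = 0. *)
pose z := sc c b; pose be2 g := be1 g ^ tr z.
have aut2 : autG grpI be2 by apply: autG_comp (autG_conj (tr_I z)) aut1.
have tr2 w : be2 (tr w) = tr w.
  by rewrite /be2 /be1 cjtr trJ ?lin_tr //; apply: tr_affine.
have d2 k w : annW k -> w \in W -> disp be2 (tv k w) = 0.
  move=> kW Ww; have kw := annW_dot kW Ww.
  rewrite (disp_conj affI tr_I aut1 tr1) ?tvW_I // -/be1 d1 // lin_tv tvE //.
  by rewrite /z dot_sc (annW_dot kW Wb) andbF; vec_eq.
have d2e : disp be2 (tv k0 a) = 0.
  rewrite (disp_conj affI tr_I aut1 tr1) // -/be1 dc lin_tv tvE //.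
  by rewrite /z dot_sc k0b; vec_eq.
have [de [deE deM deW]] := disp_normalized aut2 tr2 d2 k0a k0b d2e.
by exists (v + z), de; split=> // g Ig; rewrite -trM conjgM -deE.
Qed.
End Cocycle.

(** * Homomorphisms from I to F_2 *)

(** The second clause says that [de] factors through the action of I on V/W. *)
Definition hom_bool (de : P -> bool) :=
  {in grpI &, forall g h, de (g * h) = de g (+) de h} /\
  {in grpI, forall g, (forall x, lin g x + x \in W) -> de g = false}.

Lemma hom_boolJ de g h : hom_bool de -> g \in grpI -> h \in grpI -> de (g ^ h) = de g.
Proof.
move=> [deM _] Ig Ih; have := deM h (g ^ h) Ih; rewrite groupJ // -conjgC deM //.
by move=> /(_ isT); case: (de g); case: (de h); case: (de _).
Qed.

(* Multiplying g by the transvection that moves [lin g x] back to x enlarges the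
   subspace of vectors fixed modulo W. *)
Lemma hom_bool_tv0 de : hom_bool de ->
  (forall k u, annW k -> dot k u = false -> de (tv k u) = false) ->
  {in grpI, forall g, de g = false}.
Proof.
move=> [deM de0] de_tv g Ig; pose F g := [set y | lin g y + y \in W].
have inF g' y : (y \in F g') = (lin g' y + y \in W) by rewrite in_set.
have [m] := ubnP #|~: F g|; elim: m => // m IHm in g Ig * => lt_m.
have [/subsetP Fall|/subsetPn[x _ xF]] := boolP ([set: V] \subset F g).
  by apply: de0 => // x; have := Fall x; rewrite inF => ->.
have ag := grpI_aff Ig; set x' := lin g x.
have FD : add_closed (F g).
  split=> [|y z]; first by rewrite inF lin0 addxx W0.
  by rewrite !inF linD // GRing.addrACA => *; rewrite WD.
have FW w : w \in W -> w \in F g by move=> Ww; rewrite inF WD ?grpI_W.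
have x'F : x' \notin F g.
  move: xF; rewrite !inF => xF; rewrite (_ : lin g x' + x' = lin g (lin g x + x)) ?linD //.
  by rewrite -linD // grpI_notW.
(* A functional k vanishing on S but not at x kills the fixed space and the centre x + x', so
   [tv k (x + x')] keeps the former and sends x' to x. *)
pose S := [set y | (y \in F g) || (y + (x + x') \in F g)].
have inS y : (y \in S) = (y \in F g) || (y + (x + x') \in F g) by rewrite in_set.
have SD : add_closed S.
  have [F0 FDD] := FD; split=> [|y z]; first by rewrite inS F0.
  rewrite !inS => /orP[Fy|Fy] /orP[Fz|Fz].
  - by rewrite FDD.
  - by rewrite -(GRing.addrA y) (FDD y (z + (x + x'))) ?orbT.
  - by rewrite (GRing.addrAC y) (FDD (y + (x + x')) z) ?orbT.
  - by have := FDD _ _ Fy Fz; rewrite GRing.addrACA addxx GRing.addr0 => ->.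
have xS : x \notin S by rewrite inS negb_or xF addKv.
have [k kS kx] := separation SD xS.
have kF y : y \in F g -> dot k y = false by move=> Fy; apply: kS; rewrite inS Fy.
have kW : annW k by rewrite /annW !kF ?FW ?Wa ?Wb.
have kxx : dot k (x + x') = false.
  by apply: kS; rewrite inS addxx; case: FD => ->; rewrite orbT.
have kx' : dot k x' by move: kxx; rewrite dotD kx; case: dot.
have It := tvW_I kW kxx; set t := tv k (x + x') in It.
have at_ : affine t by apply: tv_affine.
have tE y : lin t y = y + sc (dot k y) (x + x') by rewrite lin_tv tvE.
have <- : de (g * t) = de g by rewrite deM // de_tv // addbF.
apply: IHm; rewrite ?groupM //; rewrite -ltnS; apply: leq_trans lt_m.
rewrite ltnS; rewrite proper_card // properC.
apply/andP; split.
  apply/subsetP=> y Fy; have Fy' := Fy; rewrite inF in Fy'.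
  have kgy : dot k (lin g y) = false.
    by have := annW_dot kW Fy'; rewrite dotD (kF y Fy) addbF.
  by rewrite inF linM // tE kgy GRing.addr0.
apply/subsetPn; exists x => //.
by rewrite inF linM // tE kx' /= (_ : _ + _ = 0) ?W0 //; vec_eq.
Qed.

(** With f(u) = 0, f(v) = 1 and k(v) = 0, the conjugate of [tv f u] under [tv k v] is
    [tv f u * tv k u], so [tv k u] is a commutator. Choosing v outside the span of u, a, b inside
    the kernel of k needs n > 4. *)
Lemma hom_bool_gt4 de : (4 < n)%N -> hom_bool de -> {in grpI, forall g, de g = false}.
Proof.
move=> n_gt4 hom_de; apply: hom_bool_tv0 => // k u kW ku; have [deM de0] := hom_de.
have [v vS kv] : exists2 v, v \notin spn [:: u; a; b] & dot k v = false.
  have [x xS] : exists x, x \notin spn [:: u; a; b] by apply/span_proper/ltnW.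
  case kx: (dot k x); last by exists x.
  have [y] : exists y, y \notin spn [:: x; u; a; b] by apply: span_proper.
  rewrite span_cons negb_or => /andP[yS yxS].
  by case ky: (dot k y); [exists (y + x); rewrite ?dotD ?kx ?ky | exists y].
have [f /= /and4P[/negPf fu fa fb _] fv] := separation_span vS.
have fW : annW f by rewrite /annW fa.
have := hom_boolJ hom_de (tvW_I fW fu) (tvW_I kW kv).
by rewrite tvJ // fv /= tvDl // deM ?tvW_I //; case: (de _); case: (de _).
Qed.

(** Here al(V) = V, so [al] induces a linear map h of V, which lies in I. Undoing conjugation by h
    leaves an automorphism fixing V pointwise. *)
Lemma translation_case al : (3 < n)%N -> autG grpI al ->
  (forall v x, lin (al (tr v)) x = x) ->
  exists h de, [/\ h \in grpI, hom_bool de &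
    {in grpI, forall g, al g = (g * tr (sc (de g) a)) ^ h}].
Proof.
move=> n_gt3 aut_al alR; case: (aut_al) => alM al_inj alI.
pose s v := al (tr v) 0.
have sE v : al (tr v) = tr (s v).
  by apply: lin_trP => [|x]; [exact/grpI_aff/alI/tr_I | apply: alR].
have sD u v : s (u + v) = s u + s v.
  by apply: (@tr_inj n); rewrite -sE -!trM alM ?tr_I // !sE.
have s_inj : injective s.
  by move=> u v suv; apply/tr_inj/al_inj; rewrite ?tr_I // !sE suv.
pose h := perm s_inj; have hE x : h x = s x by rewrite permE.
have h0 : h 0 = 0 by have := sD 0 0; rewrite GRing.addr0 addxx hE.
have ah : affine h by move=> x y; rewrite h0 !hE sD GRing.addr0.
have lh x : lin h x = s x by rewrite lin_def h0 hE GRing.addr0.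
have Ih : h \in grpI.
  apply/grpIP; rewrite !lh; split=> //; first by apply: (@tr_inj n); rewrite -sE (al_tra aut_al).
  by have [w Ww] := al_trW aut_al n_gt3 Wb; rewrite sE => /tr_inj ->.
pose be g := al g ^ h^-1; have aVh := affineV ah.
have aut_be : autG grpI be by apply: autG_comp (autG_conj (groupVr Ih)) aut_al.
have be_tr v : be (tr v) = tr v by rewrite /be sE trJ // -lh linKV.
have [z [de [deE deM de0]]] := fixed_translations_disp n_gt3 aut_be be_tr.
exists (tr z * h), de; split=> [||g Ig]; rewrite ?groupM ?tr_I //.
by rewrite -deE // /be -!conjgM !mulgA -(mulgA h^-1) trM addxx tr0 mulg1 mulVg conjg1.
Qed.

Theorem aut_grpI_inner al : (4 < n)%N -> autG grpI al ->
  exists2 h, h \in grpI & {in grpI, forall g, al g = g ^ h}.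
Proof.
move=> n_gt4 aut_al; have n_gt3 := ltnW n_gt4.
have alR v x := al_tr_translation aut_al n_gt3 v x n_gt4.
have [h [de [Ih hom_de alE]]] := translation_case n_gt3 aut_al alR.
exists h => // g Ig.
by rewrite alE // (hom_bool_gt4 n_gt4 hom_de Ig) /= tr0 mulg1.
Qed.

(** * Dimension four *)

Section DimensionFour.
Hypothesis n4 : n = 4%N.
Let n_gt3 : (3 < n)%N. Proof. by rewrite n4. Qed.

Lemma card_W : #|W| = 4%N.
Proof.
have aS : a \notin spn [:: b].
  by apply/negP=> /span1P[[] /eqP]; rewrite ?(negPf neq_ab) ?(negPf nza).
have bS : b \notin spn [::] by rewrite /= inE.
by rewrite /W (card_span_cons aS) (card_span_cons bS) cards1.
Qed.

Lemma span4_full x y z : x \notin W -> y \notin spn [:: x; a; b] -> z \in spn [:: y; x; a; b].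
Proof.
move=> xW yS; suff -> : spn [:: y; x; a; b] = setT by rewrite in_setT.
apply/eqP; rewrite eqEcard subsetT cardsT card_mx card_Fp // mul1n.
have -> : (2 ^ n = 16)%N by rewrite n4.
by rewrite (card_span_cons yS) (card_span_cons xW) -/W card_W.
Qed.

(** V/W is a plane, so the kernel of a nonzero functional on it has order two and is spanned by
    u. *)
Lemma annW_mod u k x : u \notin W -> annW k -> k != 0 -> dot k u = false -> dot k x = false ->
  (x \in W) || (x + u \in W).
Proof.
move=> uW kW nzk ku kx; rewrite -span_cons; apply/negPn/negP => xS.
have [z kz] := dot_neq0 nzk; have := span4_full z uW xS.
have [ka kb] := (annW_dot kW Wa, annW_dot kW Wb).
rewrite (span_cons x) !(span_cons u) -/W => /orP[/orP[]|/orP[]] /(annW_dot kW);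
by rewrite ?dotD ?kx ?ku kz.
Qed.

(** * The exceptional automorphism of I for n = 4 *)

(** In coordinates s, t on the plane V/W this is the anisotropic form s^2 + st + t^2. *)
Definition quad x := x \notin W.

Lemma quad_shift u k x : u \notin W -> annW k -> k != 0 -> dot k u = false ->
  quad (x + u) = ~~ (quad x (+) dot k x).
Proof.
move=> uW kW nzk ku; rewrite /quad; case kx: (dot k x).
  have xW : x \notin W by apply: contraTN kx => /(annW_dot kW) ->.
  have xuW : x + u \notin W by apply: contraTN kx => /(annW_dot kW); rewrite dotD ku addbF => ->.
  by rewrite xW xuW.
have [xW|xW] := boolP (x \in W); first by rewrite WDl ?uW.
by have := annW_mod uW kW nzk ku kx; rewrite (negPf xW) /= => ->.
Qed.

Lemma quad_affine v : exists k, annW k /\ forall x, quad (x + v) (+) quad x = dot k x (+) quad v.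
Proof.
have [vW|vW] := boolP (v \in W).
  exists 0; rewrite /annW !dot0l; split=> // x.
  by rewrite /quad WDr // vW dot0l addbb.
have [k /= /and4P[/negPf kv ka kb _] nzk] := @annihilator n [:: v; a; b] n_gt3.
have kW : annW k by rewrite /annW ka.
exists k; split=> // x; rewrite (quad_shift x vW kW nzk kv) [quad v]vW.
by case: (quad x); case: dot.
Qed.

Lemma quadW x w : w \in W -> quad (x + w) = quad x.
Proof. by move=> Ww; rewrite /quad WDr. Qed.

(* By [quad_affine], [quad] is a quadratic form whose polar form vanishes on W; this makes
   conjugation by [pi] preserve affineness. *)
Definition pi_fun x := x + sc (quad x) a.
Lemma pi_funK : involutive pi_fun.
Proof. by move=> x; rewrite /pi_fun quadW ?Wsc ?Wa // addvK. Qed.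
Definition pi : P := locked (perm (can_inj pi_funK)).
Lemma piE x : pi x = x + sc (quad x) a. Proof. by rewrite /pi -lock permE. Qed.
Lemma piV : pi^-1 = pi.
Proof. by apply/eqP; rewrite eq_invg_mul; apply/eqP/permP=> x; rewrite permM !piE -!/(pi_fun _) pi_funK perm1. Qed.
Lemma pi2 : pi * pi = 1.
Proof. by rewrite -{1}piV mulVg. Qed.

Lemma conj_piE g x : g \in grpI -> (g ^ pi) x = g x + sc (quad (g x) (+) quad x) a.
Proof.
move=> Ig; have ag := grpI_aff Ig.
have gx : g (x + sc (quad x) a) = g x + sc (quad x) a.
  by rewrite GRing.addrC affE // lin_sc (grpI_a Ig) GRing.addrC.
rewrite conjgE piV !permM !piE gx.
by rewrite quadW ?Wsc ?Wa // -GRing.addrA scD addbC.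
Qed.

Lemma quad_lin g x : g \in grpI -> quad (lin g x) = quad x.
Proof.
move=> Ig; rewrite /quad; have [xW|xW] := boolP (x \in W); first by rewrite grpI_W.
by rewrite grpI_notW.
Qed.

(** The linear part of g preserves [quad], and a shift changes [quad] by an affine function
    ([quad_affine]), so the correction to g is affine in x. *)
Lemma conj_pi_lin g : g \in grpI -> exists k, annW k /\
  forall x, (g ^ pi) x = g x + sc (dot k x (+) quad (g 0)) a.
Proof.
move=> Ig; have [k [kW kE]] := quad_affine (g 0).
have [l lW lE] := grpI_annW (groupVr Ig) kW.
have ag := grpI_aff Ig.
exists l; split=> // x; rewrite conj_piE //; congr (_ + sc _ a).
by rewrite (linE g x) -(quad_lin x Ig) kE -(lE (lin g x)) linKV.
Qed.

Lemma conj_pi_I g : g \in grpI -> g ^ pi \in grpI.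
Proof.
move=> Ig; have ag := grpI_aff Ig; have [k [kW gE]] := conj_pi_lin Ig.
have ag' : affine (g ^ pi) by move=> x y; rewrite !gE ag dotD dot0; move: (quad _) => c; vec_eq.
have lE w : w \in W -> lin (g ^ pi) w = lin g w.
  by move=> Ww; rewrite !lin_def !gE (annW_dot kW Ww) dot0; move: (quad _) => c; vec_eq.
by apply/grpIP; rewrite (lE _ Wa) (lE _ Wb) (grpI_a Ig); split=> //; apply: grpI_W Wb.
Qed.

Lemma aut_conj_pi : autG grpI (conjg^~ pi).
Proof. by split=> [g h _ _|g h _ _ /conjg_inj|g /conj_pi_I]; rewrite ?conjMg. Qed.

Lemma pi_tra c : tr (sc c a) ^ pi = tr (sc c a).
Proof.
by apply/permP=> x; rewrite conj_piE ?tr_I // trE quadW ?Wsc ?Wa // addbb GRing.addr0.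
Qed.

(** If some image is not a translation, [al_tr_nontranslation] gives an image [tv k a * tr u], which
    [pi] turns into a translation. The remaining translations by vectors outside W are conjugate in
    I to its preimage, and those by W are centralised by [pi]. *)
Lemma al_tr_or_pi al : autG grpI al -> (forall v x, lin (al (tr v)) x = x) \/
  (forall v x, lin (al (tr v) ^ pi) x = x).
Proof.
move=> aut_al.
have [/forallP alR|/forallPn[v /forallPn[x nt]]] :=
    boolP [forall v, forall x, lin (al (tr v)) x == x].
  by left=> v x; apply/eqP; have /forallP := alR v; apply.
right=> v' z.
have [u [y [k [uW kW nzk ku ey]]]] := al_tr_nontranslation aut_al n_gt3 nt.
have ka := annW_dot kW Wa.
have yT : al (tr y) ^ pi = tr (u + a).
  have Ig : al (tr y) \in grpI by case: aut_al => _ _; apply; apply: tr_I.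
  apply/permP=> t; rewrite conj_piE // ey permM tvE // !trE.

  have -> : quad (t + sc (dot k t) a + u) = quad (t + u).
    by rewrite GRing.addrAC quadW // Wsc ?Wa.
  by rewrite (quad_shift t uW kW nzk ku); case: (quad t); vec_eq.
have [v'W|v'W] := boolP (v' \in W).
  have [w' Ww' ->] := al_trW aut_al n_gt3 v'W.
  rewrite (_ : tr w' ^ pi = tr w') ?lin_tr //; apply/permP=> t.
  by rewrite conj_piE ?tr_I // trE quadW // addbb GRing.addr0.
have yW : y \notin W.
  apply/negP=> /(al_trW aut_al n_gt3)[w' Ww' e]; move: yT; rewrite e.
  rewrite (_ : tr w' ^ pi = tr w') => [/tr_inj w'E|].
    by case/negP: uW; rewrite -(addvK u a) -w'E WD ?Wa.
  by apply/permP=> t; rewrite conj_piE ?tr_I // trE quadW // addbb GRing.addr0.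
have [f [fW fy fv']] := sepW2 yW v'W.
have fyv : dot f (y + v') = false by rewrite dotD fy fv'.
have Ih := tvW_I fW fyv; have Igh : al (tv f (y + v')) \in grpI by case: aut_al => _ _; apply.
have -> : tr v' = tr y ^ tv f (y + v').
  rewrite trJ ?lin_tv ?tvE // ?fy ?addKv //; exact: tv_affine.
rewrite (autGJ aut_al) ?tr_I // conjJg yT trJ ?lin_tr //.
exact/grpI_aff/conj_pi_I.
Qed.

(** GL(V/W) is S_3, generated by three conjugate transvections; a homomorphism is determined by its
    value on one of them, where [la] is 1. *)
Lemma sign_character : exists la, hom_bool la /\
  (exists k u, [/\ annW k, u \notin W, dot k u = false & la (tv k u)]) /\
  (forall de, hom_bool de -> exists e, {in grpI, forall g, de g = e && la g}).
Proof.
have [p [q [l [m [[pW qW pqW lW mW] [lp lq mp mq]]]]]] := two_coords n_gt3.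
have lw w := @annW_dot l w lW; have mw w := @annW_dot m w mW.
(* p and q form a basis of V modulo W, with coordinates l and m. *)
have decW x : x + sc (dot l x) p + sc (dot m x) q \in W.
  have : x \in spn [:: q; p; a; b].
    by apply: span4_full => //; rewrite span_cons negb_or qW GRing.addrC.
  rewrite (span_cons q) !(span_cons p) -/W => /orP[/orP[]|/orP[]] xW.
  - by rewrite !(lw x) ?(mw x) // !GRing.addr0.
  - have := lw _ xW; have := mw _ xW; rewrite !dotD lp mp addbF => ->.
    by rewrite addbT => /negbFE ->; rewrite GRing.addr0.
  - have := lw _ xW; have := mw _ xW; rewrite !dotD lq mq addbF addbT => /negbFE -> ->.
    by rewrite GRing.addr0.
  - have := lw _ xW; have := mw _ xW; rewrite !dotD lq mq lp mp !addbF !addbT.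
    by move=> /negbFE -> /negbFE ->; rewrite GRing.addrAC.
pose A g := dot l (lin g p); pose B g := dot m (lin g p).
pose C g := dot l (lin g q); pose D g := dot m (lin g q).
(* The sign of an invertible 2 x 2 matrix ((A, B), (C, D)) over F_2 is BC + BD + AC. *)
pose la g := (B g && C g) (+) (B g && D g) (+) (A g && C g).
have notW x : x \notin W -> dot l x || dot m x.
  apply: contraR; rewrite negb_or => /andP[/negPf lx /negPf mx].
  by have := decW x; rewrite lx mx !GRing.addr0.
have decg g x k : g \in grpI -> annW k -> 
    dot k (lin g x) = dot l x && dot k (lin g p) (+) dot m x && dot k (lin g q).
  move=> Ig kW; have := annW_dot kW (grpI_W Ig (decW x)).
  rewrite !linD ?lin_sc; try exact: grpI_aff.
  by rewrite !dotD !dot_sc; case: (dot k (lin g x)); case: (_ && _); case: (_ && _).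
have inv g : g \in grpI -> (A g && D g) (+) (B g && C g).
  move=> Ig; have := notW _ (grpI_notW Ig pW); have := notW _ (grpI_notW Ig qW).
  have := notW _ (grpI_notW Ig pqW); rewrite linD; last exact: grpI_aff.
  rewrite !dotD -/(A g) -/(B g) -/(C g) -/(D g).
  by case: (A g); case: (B g); case: (C g); case: (D g).
have hom_la : hom_bool la.
  split=> [g h Ig Ih|g Ig gW].
    rewrite /la /A /B /C /D !linM; try exact: grpI_aff.
    rewrite !(decg h (lin g p) _ Ih) // !(decg h (lin g q) _ Ih) // -/(A g) -/(B g) -/(C g) -/(D g).
    rewrite -/(A h) -/(B h) -/(C h) -/(D h); have := inv g Ig; have := inv h Ih.
    case: (A g); case: (B g); case: (C g); case: (D g) => //;
    by case: (A h); case: (B h); case: (C h); case: (D h).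
  have modW k x : annW k -> dot k (lin g x) = dot k x.
    by move=> kW; have := annW_dot kW (gW x); rewrite dotD; case: dot; case: dot.
  by rewrite /la /A /B /C /D !modW // lp lq mp mq.
exists la; split=> //; split.
  exists l, q; split=> //.
  by rewrite /la /A /B /C /D !lin_tv !tvE // !dotD !dot_sc lp lq mp mq.
move=> de hom_de; exists (de (tv l q)) => g Ig.
(* Subtracting the multiple of [la] that agrees with [de] at [tv l q] leaves a homomorphism to be
   shown zero. *)
pose de' g := de g (+) (de (tv l q) && la g).
suff : de' g = false by rewrite /de'; case: (de g); case: (_ && _).
have hom_de' : hom_bool de'.
  have [[deM de0] [laM la0]] := (hom_de, hom_la); split=> [g1 g2 Ig1 Ig2|g1 Ig1 gW].
    rewrite /de' deM // laM //.
    by case: (de g1); case: (de g2); case: (de _); case: (la g1); case: (la g2).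
  by rewrite /de' de0 // la0 // andbF.
have [dM d0] := hom_de'; have [laM la0] := hom_la.
apply: hom_bool_tv0 Ig => {g} // k u kW ku.
have d1 : de' (tv l q) = false.
  by rewrite /de' /la /A /B /C /D !lin_tv !tvE // !dotD !dot_sc lp lq mp mq /= andbT addbb.
clearbody de' la.
have lmpq : dot (l + m) (p + q) = false by rewrite !vecE lp lq mp mq.
(* Two of the transvections conjugate each other to the third. *)
have e1 : tv l q ^ tv m p = tv (l + m) (p + q).
  apply/permP=> x; rewrite conjgE tvV !permM !tvE // !vecE ?lp ?lq ?mp ?mq /=.
  by vec_eq.
have e2 : tv m p ^ tv l q = tv (l + m) (p + q).
  apply/permP=> x; rewrite conjgE tvV !permM !tvE // !vecE ?lp ?lq ?mp ?mq /=.
  by vec_eq.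
have [I1 I2] := (tvW_I lW lq, tvW_I mW mp).
have d3 : de' (tv (l + m) (p + q)) = false by rewrite -e1 (hom_boolJ hom_de').
have d2 : de' (tv m p) = false by rewrite -(hom_boolJ hom_de' I2 I1) e2.
(* A transvection acts on V/W according to its axis and the class of its centre modulo W alone. *)
have eqT k' u' : annW k' -> dot k' u' = false -> dot k =1 dot k' -> u + u' \in W ->
    de' (tv k' u') = false -> de' (tv k u) = false.
  move=> k'W k'u' kk' Wu dk'; have I := tvW_I kW ku; have I' := tvW_I k'W k'u'.
  have [at_ at'] := (tv_affine k u, tv_affine k' u').
  have : de' (tv k u * tv k' u') = false.
    apply: d0 => [|x]; rewrite ?groupM // linM // !lin_tv !tvE // !vecE -!kk' ku andbF addbF.
    rewrite (_ : _ + _ = sc (dot k x) (u + u')) ?Wsc //; vec_eq.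
  by rewrite dM // dk' addbF.
have kE x : dot k x = dot l x && dot k p (+) dot m x && dot k q.
  have := annW_dot kW (decW x); rewrite !dotD !dot_sc.
  by case: (dot k x); case: (_ && _); case: (_ && _).
(* The condition k(u) = 0 leaves the trivial cases, u in W or k = 0, and the three transvections of
   V/W. *)
have uW := decW u; move: (kE u); rewrite ku.
case kp: (dot k p); case kq: (dot k q); case lu: (dot l u); case mu: (dot m u) => // _;
  rewrite lu mu /= ?GRing.addr0 in uW.
all: try by apply: d0 => [|x]; rewrite ?tvW_I // lin_tv tvE // GRing.addrAC addxx GRing.add0r Wsc.
all: try by apply: d0 => [|x]; rewrite ?tvW_I // lin_tv tvE // kE kp kq !andbF GRing.addr0 addxx W0.
- apply: (eqT (l + m) (p + q)) => // [|x|]; rewrite ?annWD //.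
    by rewrite kE kp kq !andbT dotDl.
  by rewrite GRing.addrA.
- by apply: (eqT l q) => // x; rewrite kE kp kq andbT andbF addbF.
- by apply: (eqT m p) => // x; rewrite kE kp kq andbT andbF.
Qed.

Lemma sc_b_neq_a c : sc c b != a.
Proof. by case: c; rewrite //= eq_sym. Qed.

Lemma grpB_aff : {in grpB, forall g, affine g}. Proof. by move=> g /grpBP[]. Qed.
Lemma grpC_aff : {in grpC, forall g, affine g}. Proof. by move=> g /grpCP[]. Qed.
Lemma grpI_subB : grpI \subset grpB. Proof. exact: subsetIl. Qed.
Lemma grpI_subC : grpI \subset grpC. Proof. exact: subsetIr. Qed.
Lemma tr_B v : tr v \in grpB. Proof. by rewrite (subsetP grpI_subB) ?tr_I. Qed.
Lemma tr_C v : tr v \in grpC. Proof. by rewrite (subsetP grpI_subC) ?tr_I. Qed.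

Lemma tv_B k u : dot k a = false -> dot k u = false -> tv k u \in grpB.
Proof.
move=> ka ku; apply/grpBP; rewrite lin_tv tvE // ka GRing.addr0; split=> //.
exact: tv_affine.
Qed.

Lemma tv_C k u : u \in W -> dot k u = false -> tv k u \in grpC.
Proof.
move=> Wu ku; apply/grpCP; split=> [|w Ww]; first exact: tv_affine.
by rewrite lin_tv tvE // WD ?Wsc.
Qed.

(** [tv k (u + b)] exchanges u and b and fixes a, so it lies in B but not in C. *)
Lemma b_swap u : u \notin W -> exists k,
  [/\ dot k a = false, dot k u, dot k b & dot k (u + b) = false].
Proof.
move=> uW; have: b \notin spn [:: u + b; a].
  rewrite span_cons (GRing.addrC u) addKv negb_or; apply/andP; split.
    by apply/negP=> /span1P[c /esym/eqP]; rewrite (negPf (sc_a_neq_b c)).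
  by apply: contra uW => /span1P[c ->]; rewrite Wsc ?Wa.
case/separation_span=> k /= /and3P[/negPf kub /negPf ka _] kb.
by exists k; split=> //; move: kub; rewrite dotD kb; case: dot.
Qed.

(** [tv k (a + b)] exchanges a and b and fixes u, so it lies in C but not in B. *)
Lemma ab_swap u : u \notin W -> exists k,
  [/\ dot k u = false, dot k a, dot k b & dot k (a + b) = false].
Proof.
move=> uW; have: a \notin spn [:: u; a + b].
  rewrite span_cons negb_or; apply/andP; split.
    apply/negP=> /span1P[[] /= /eqP]; last by rewrite (negPf nza).
    by rewrite eq_sym addv_id (negPf nzb).
  apply/negP=> /span1P[c e]; case/negP: uW.
  by rewrite -(addKv u a) e WD ?Wsc ?WD ?Wa ?Wb.
case/separation_span=> k /= /and3P[/negPf ku /negPf kab _] ka.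
by exists k; split=> //; move: kab; rewrite dotD ka; case: dot.
Qed.

Lemma pi_tr_I v : tr v ^ pi \in grpI.
Proof. by apply/conj_pi_I/tr_I. Qed.

(** The coefficient of a is the polar form of [quad] at x and v. *)
Lemma lin_pi_tr v x :
  lin (tr v ^ pi) x = x + sc (quad (x + v) (+) quad x (+) quad v) a.
Proof.
have quad0 : quad 0 = false by rewrite /quad W0.
rewrite lin_def !conj_piE ?tr_I // !trE GRing.add0r quad0 addbF.
by move: (quad _) (quad _) (quad v) => c d e; vec_eq.
Qed.

Lemma conj_pi_lin_mod g x : g \in grpI -> exists c, lin (g ^ pi) x = lin g x + sc c a.
Proof.
move=> Ig; have [k [_ gE]] := conj_pi_lin Ig; exists (dot k x).
by rewrite !lin_def !gE dot0; move: (quad _) => c; vec_eq.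
Qed.

(** * The four twists of I and the amalgams glued along them *)

Section Twists.
Variable la : P -> bool.
Hypothesis hom_la : hom_bool la.

Definition twist (i j : bool) g := (if i then g ^ pi else g) * tr (sc (j && la g) a).

Lemma la_modW g : g \in grpI -> (forall x, lin g x + x \in W) -> la g = false.
Proof. by case: hom_la => _; apply. Qed.
Lemma laM g h : g \in grpI -> h \in grpI -> la (g * h) = la g (+) la h.
Proof. by case: hom_la => + _; apply. Qed.
Lemma la_tr v : la (tr v) = false.
Proof. by apply: la_modW => [|x]; rewrite ?tr_I // lin_tr addxx W0. Qed.

(** Conjugation by [pi] changes linear parts only by multiples of a, so the action on V/W is
    unchanged. *)
Lemma la_pi g : g \in grpI -> la (g ^ pi) = la g.
Proof.
move=> Ig; have Ip := conj_pi_I Ig; have IV := groupVr Ig; have ag := grpI_aff Ig.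
have aV := grpI_aff IV.
have : la (g ^ pi * g^-1) = false.
  apply: la_modW => [|x]; first exact: groupM.
  rewrite (linM _ _ aV); have [c ->] := conj_pi_lin_mod x Ig.
  by rewrite linD // linKV // GRing.addrAC addxx GRing.add0r lin_sc (grpI_a IV) Wsc ?Wa.
have : la (g * g^-1) = false by rewrite mulgV -(tr0 n) la_tr.
by rewrite (laM Ig IV) (laM Ip IV); case: (la g); case: (la g^-1); case: (la _).
Qed.

Lemma twist_tr i j v : twist i j (tr v) = if i then tr v ^ pi else tr v.
Proof. by rewrite /twist la_tr andbF tr0 mulg1. Qed.

Lemma twist_trW i j w : w \in W -> twist i j (tr w) = tr w.
Proof.
move=> Ww; rewrite twist_tr; case: i => //; apply/permP=> x.
by rewrite conj_piE ?tr_I // trE quadW // addbb GRing.addr0.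
Qed.

Lemma base_I (i : bool) g : g \in grpI -> (if i then g ^ pi else g) \in grpI.
Proof. by case: i => // /conj_pi_I. Qed.

Lemma twist_I i j g : g \in grpI -> twist i j g \in grpI.
Proof. by move=> Ig; rewrite groupM ?tr_I ?base_I. Qed.

Lemma la_twist i j g : g \in grpI -> la (twist i j g) = la g.
Proof.
by move=> Ig; rewrite laM ?base_I ?tr_I // la_tr addbF; case: i; rewrite // la_pi.
Qed.

Lemma tra_comm c g : g \in grpI -> commute (tr (sc c a)) g.
Proof.
move=> Ig; apply/commgP/conjg_fixP; rewrite trJ ?lin_sc ?(grpI_a Ig) //.
exact: grpI_aff.
Qed.

Lemma twistK i j g : g \in grpI -> twist i j (twist i j g) = g.
Proof.
move=> Ig; rewrite {1}/twist la_twist // /twist; case: i.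
  by rewrite conjMg pi_tra -conjgM pi2 conjg1 -mulgA trM addxx tr0 mulg1.
by rewrite -mulgA trM addxx tr0 mulg1.
Qed.

Lemma aut_twist i j : autG grpI (twist i j).
Proof.
split=> [g h Ig Ih|g h Ig Ih e|g]; last exact: twist_I.
  have -> : twist i j (g * h) =
     (if i then g ^ pi else g) * (if i then h ^ pi else h) *
     (tr (sc (j && la g) a) * tr (sc (j && la h) a)).
    rewrite /twist laM // trM scD; congr (_ * tr (sc _ a)).
      by case: i; rewrite ?conjMg.
    by case: j.
  rewrite /twist !mulgA; congr (_ * _); rewrite -!mulgA; congr (_ * _).
  by apply/commute_sym/tra_comm/base_I.
by rewrite -(twistK i j Ig) e twistK.
Qed.

Lemma aut_grpI_twist al : autG grpI al ->
  (forall de, hom_bool de -> exists e, {in grpI, forall g, de g = e && la g}) ->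
  exists h i j, h \in grpI /\ {in grpI, forall g, al g = twist i j g ^ h}.
Proof.
move=> aut_al la_univ; have [alR|alR] := al_tr_or_pi aut_al.
  have [h [de [Ih hom_de alE]]] := translation_case n_gt3 aut_al alR.
  have [j deE] := la_univ de hom_de.
  by exists h, false, j; split=> // g Ig; rewrite alE // /twist deE.
have aut_al' := autG_comp aut_conj_pi aut_al.
have [h [de [Ih hom_de alE]]] := translation_case n_gt3 aut_al' alR.
have [j deE] := la_univ de hom_de.
exists (h ^ pi), true, j; split=> [|g Ig]; first exact: conj_pi_I.
have /= := alE g Ig; move/(congr1 (conjg^~ pi)) => /=.
by rewrite -conjgM pi2 conjg1 => ->; rewrite conjJg (conjMg g) pi_tra /twist deE.
Qed.

Section NoExtension.
Variables (G : {group P}) (be : P -> P) (i j : bool).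
Hypotheses (affG : {in G, forall g, affine g}) (IG : grpI \subset G) (aut_be : autG G be).
Hypothesis beE : {in grpI, forall g, be g = twist i j g}.

Let trG v : tr v \in G. Proof. by rewrite (subsetP IG) ?tr_I. Qed.

(** If i is set, [be] carries V to its conjugate under [pi], which inherits normality in G from
    V. *)
Lemma ext_pi_trJ v g : i -> g \in G -> exists v', (tr v ^ pi) ^ g = tr v' ^ pi.
Proof.
move=> i1 Gg; have [g' Gg' <-] := autG_surj aut_be Gg.
have trE' w : tr w ^ pi = be (tr w) by rewrite beE ?tr_I // twist_tr i1.
have ag' := affG Gg'.
exists (lin g' v); rewrite !trE' -(autGJ aut_be) ?trG // trJ //.
Qed.

Lemma ext_fix_tr v : i = false -> be (tr v) = tr v.
Proof. by move=> i0; rewrite beE ?tr_I // twist_tr i0. Qed.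

Lemma ext_disp_tv k u : i = false -> j -> annW k -> dot k u = false ->
  disp be (tv k u) = sc (la (tv k u)) a.
Proof.
move=> i0 j1 kW ku; rewrite /disp beE ?tvW_I // /twist i0 j1 permM trE tv0.
by rewrite GRing.addr0 GRing.add0r.
Qed.
End NoExtension.

(** A nontrivial K1 yields [tr a] by commutators inside B; swapping a with b in C, then b with p in
    B, yields [tr p] with p outside W. On the C side this is its conjugate under [pi], from which an
    element is built that a last swap in B moves out of I. *)
Lemma twist_core j (K1 K2 : {group P}) : K1 \subset grpI -> K2 \subset grpI ->
  grpB \subset 'N(K1) -> grpC \subset 'N(K2) -> K1 :=: twist true j @: K2 -> K1 :=: 1.
Proof.
move=> /subsetP sK1I /subsetP sK2I nB nC K1E; apply/trivgP/subsetP=> g Kg.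
rewrite inE; apply/negPn/negP=> nzg.
have K1J (x y : P) : x \in K1 -> y \in grpB -> x ^ y \in K1.
  by move=> Kx By; rewrite memJ_norm // (subsetP nB).
have K2J (x y : P) : x \in K2 -> y \in grpC -> x ^ y \in K2.
  by move=> Kx Cy; rewrite memJ_norm // (subsetP nC).
have twK2 (y : P) : y \in grpI -> twist true j y \in K1 -> y \in K2.
  move=> Iy; rewrite K1E => /imsetP[z Kz e].
  by rewrite -(twistK true j Iy) e twistK // sK2I.
have twK1 (y : P) : y \in K2 -> twist true j y \in K1 by move=> Ky; rewrite K1E imset_f.
have Wab : a + b \in W by rewrite WD ?Wa ?Wb.
have [p [q [_ [_ [[pW qW pqW _ _] _]]]]] := two_coords n_gt3.
have Kta : tr a \in K1.
  have [v nzv Kv] : exists2 v, v != 0 & tr v \in K1.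
    have ag := grpI_aff (sK1I _ Kg).
    have [/forallP g1|/forallPn[v nv]] := boolP [forall v, lin g v == v].
      have gE := lin_trP ag (fun v => eqP (g1 v)); exists (g 0); last by rewrite -gE.
      by apply: contraNneq nzg => g0; rewrite gE g0 tr0.
    exists (lin g v + v); first by rewrite addv_eq0.
    have -> : tr (lin g v + v) = g^-1 * g ^ tr v by rewrite -trM -trJ // !conjgE trV !mulgA.
    by rewrite groupM ?groupV // K1J ?tr_B.
  have [/span1P[[] e]|] := boolP (v \in spn [:: a]); first by rewrite /= in e; rewrite -e.
    by rewrite e eqxx in nzv.
  case/separation_span=> k /= /andP[/negPf ka _] kv.
  have Bt := tv_B ka ka; have := groupM Kv (K1J _ _ Kv Bt).
  by rewrite trJ_tv // kv trM addKv.
have Ktb2 : tr b \in K2.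
  have Kta2 : tr a \in K2 by apply: twK2; rewrite ?tr_I // twist_trW ?Wa.
  have [k [kp ka kb kab]] := ab_swap pW.
  have := K2J _ _ Kta2 (tv_C Wab kab).
  by rewrite trJ_tv // ka addKv.
have Ktb : tr b \in K1 by rewrite -(twist_trW true j Wb) twK1.
have Ktp : tr p \in K1.
  have [k [ka kp kb kpb]] := b_swap pW; have := K1J _ _ Ktb (tv_B ka kpb).
  by rewrite trJ_tv // kb (_ : _ + _ = p) //; vec_eq.
have Kr : tr p ^ pi \in K2.
  apply: twK2; first exact: pi_tr_I.
  by rewrite /twist la_pi ?tr_I // la_tr andbF tr0 mulg1 -conjgM pi2 conjg1.
have [k [kq ka kb kab]] := ab_swap qW; have Cg := tv_C Wab kab.
set r := tr p ^ pi in Kr; set t := tv k (a + b) in Cg.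
(* The linear part of y sends q to q + b modulo a. The swap of b and q then turns its twist into an
   element sending b outside W. *)
have Kt := K2J _ _ Kr Cg; have Ky := groupM Kr Kt; set y := r * r ^ t in Ky.
have at_ : affine t by apply: grpC_aff.
have [ar art] := (grpI_aff (sK2I _ Kr), grpI_aff (sK2I _ Kt)).
have rq : lin r q = q + a by rewrite lin_pi_tr /quad (GRing.addrC q p) pqW qW pW.
have yq : lin y q = q + b + a.
  rewrite linM // rq linD // (grpI_a (sK2I _ Kt)); congr (_ + a).
  rewrite lin_tvJ // (tvE q) // kq GRing.addr0 rq tvE // dotD kq ka /=.
  by vec_eq.
have [c tyq] : exists c, lin (twist true j y) q = q + b + sc c a.
  have [c cE] := conj_pi_lin_mod q (sK2I _ Ky).
  exists (~~ c); rewrite linM ?lin_tr; last exact: tr_affine.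
  by rewrite cE yq; vec_eq.
have [l [la_ lq lb lqb]] := b_swap qW; have Bs := tv_B la_ lqb.
have /sK1I/grpIP[_ _] := K1J _ _ (twK1 _ Ky) Bs.
have aty := grpI_aff (twist_I true j (sK2I _ Ky)); have as_ := grpB_aff Bs.
have bq : b + (q + b) = q by vec_eq.
rewrite lin_tvJ // (tvE b) // lb /= bq tyq tvE // dotD lqb dot_sc la_ andbF /=.
by rewrite GRing.addr0 WDr ?Wsc ?Wa // WDr ?Wb // (negPf qW).
Qed.

Hypothesis la_ex : exists k u, [/\ annW k, u \notin W, dot k u = false & la (tv k u)].

Lemma la_tvW k w : annW k -> w \in W -> la (tv k w) = false.
Proof.
move=> kW Ww; have kw := annW_dot kW Ww; apply: la_modW => [|x]; first exact: tvW_I.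
by rewrite lin_tv tvE // GRing.addrAC addxx GRing.add0r Wsc.
Qed.

(** If i were set, the conjugate of V under [pi] would be normal in B; it fixes b, but a conjugate
    under [tv k p] with k(b) = 1 does not. If j were set, [dispJ] for the conjugates [tv k u] and
    [tv k b], on which [la] differs, would make a a multiple of b. *)
Lemma no_ext_B be i j : autG grpB be -> {in grpI, forall g, be g = twist i j g} ->
  i = false /\ j = false.
Proof.
move=> aut_be beE.
have i0 : i = false.
  apply/negP=> i1; have [p [q [_ [_ [[pW qW pqW _ _] _]]]]] := two_coords n_gt3.
  have [k /= /and3P[/negPf kp /negPf ka _] kb] :
      exists2 k, all (fun y => ~~ dot k y) [:: p; a] & dot k b.
    apply: separation_span; rewrite span_cons negb_or; apply/andP; split.
      by apply/negP=> /span1P[c /esym/eqP]; rewrite (negPf (sc_a_neq_b c)).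
    apply: contra pW => /span1P[c e]; rewrite -(addKv p b) e.
    by rewrite WD ?Wsc ?Wa ?Wb.
  have Bg := tv_B ka kp; have [v e] := ext_pi_trJ grpB_aff grpI_subB aut_be beE q i1 Bg.
  have ag := grpB_aff Bg; have aq := grpI_aff (pi_tr_I q).
  have := congr1 (fun g => lin g b) e.
  rewrite lin_tvJ // (tvE b) // kb /= !lin_pi_tr.
  have qb x : quad (b + x) = quad x by rewrite GRing.addrC quadW ?Wb.
  have -> : quad (b + p + q) = true by rewrite -GRing.addrA qb.
  have qb0 : quad b = false by rewrite /quad Wb.
  have [qp qq] : quad p = true /\ quad q = true by [].
  rewrite !qb qb0 qp qq addbF !addbb /= tvE // !dotD kp kb ka /= => /eqP.
  by rewrite -addv_eq0 (_ : _ + _ = a) ?(negPf nza) //; vec_eq.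
split=> //; apply/negP=> j1; have be_tr v := ext_fix_tr beE v i0.
have [k [u [kW uW ku lku]]] := la_ex.
have [l [la_ lu lb lub]] := b_swap uW; have Bg := tv_B la_ lub.
have [kb ka] := (annW_dot kW Wb, annW_dot kW Wa).
have tJ : tv k u ^ tv l (u + b) = tv k b.
  apply/permP=> x; rewrite conjgE tvV !permM !tvE // !vecE lu lb ku kb /= !andbF !addbF.
  by vec_eq.
have Bt : tv k u \in grpB by apply: tv_B.
have := dispJ grpB_aff tr_B aut_be be_tr Bg Bt.
rewrite tJ (ext_disp_tv beE i0 j1 kW ku) (ext_disp_tv beE i0 j1 kW kb) lku la_tvW ?Wb //.
rewrite !lin_tv (tvE _ kb) (tvE _ lub) la_ /= => /eqP.
rewrite -addv_eq0 (_ : _ + _ = sc (dot k (disp be (tv l (u + b)))) b + a); last by vec_eq.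
by rewrite addv_eq0 (negPf (sc_b_neq_a _)).
Qed.

(** The conjugate of V under [pi] displaces vectors only along a, whereas swapping a and b in C
    gives a displacement b. For j, the swap commutes with [tv k u], whose displacement is a; [dispJ]
    would make a + b a multiple of u. *)
Lemma no_ext_C be i j : autG grpC be -> {in grpI, forall g, be g = twist i j g} ->
  i = false /\ j = false.
Proof.
move=> aut_be beE; have Wab : a + b \in W by rewrite WD ?Wa ?Wb.
have i0 : i = false.
  apply/negP=> i1; have [p [q [_ [_ [[pW qW pqW _ _] _]]]]] := two_coords n_gt3.
  have [k [kp ka kb kab]] := ab_swap pW.
  have Cg := tv_C Wab kab; have [v e] := ext_pi_trJ grpC_aff grpI_subC aut_be beE q i1 Cg.
  have ag := grpC_aff Cg; have aq := grpI_aff (pi_tr_I q).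
  have := congr1 (fun g => lin g p) e.
  rewrite lin_tvJ // (tvE p) // kp /= GRing.addr0 !lin_pi_tr; set c := _ (+) _ (+) quad v.
  rewrite /quad pW qW pqW /= tvE // dotD kp ka /= => /eqP.
  rewrite -addv_eq0 (_ : _ + _ = sc c a + b); last by vec_eq.
  by rewrite addv_eq0 (negPf (sc_a_neq_b _)).
split=> //; apply/negP=> j1; have be_tr v := ext_fix_tr beE v i0.
have [k [u [kW uW ku lku]]] := la_ex.
have [l [lu la_ lb lab]] := ab_swap uW; have Cg := tv_C Wab lab.
have [kb ka] := (annW_dot kW Wb, annW_dot kW Wa).
have tJ : tv k u ^ tv l (a + b) = tv k u.
  by rewrite tvJ // dotD ka kb /= GRing.addr0.
have Ct : tv k u \in grpC by rewrite (subsetP grpI_subC) ?tvW_I.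
have := dispJ grpC_aff tr_C aut_be be_tr Cg Ct.
rewrite tJ (ext_disp_tv beE i0 j1 kW ku) lku !lin_tv (tvE _ ku) (tvE _ lab) la_ /= => /eqP.
rewrite -addv_eq0 (_ : _ + _ = sc (dot k (disp be (tv l (a + b)))) u + (a + b)); last by vec_eq.
rewrite addv_eq0; case: (dot k _) => /= /eqP e; first by case/negP: uW; rewrite e.
by move: neq_ab; rewrite -addv_eq0 -e eqxx.
Qed.

Lemma twist_comp i j i' j' g : g \in grpI ->
  twist i j (twist i' j' g) = twist (i (+) i') (j (+) j') g.
Proof.
move=> Ig; rewrite {1}/twist la_twist // /twist.
have -> : sc ((j (+) j') && la g) a = sc (j' && la g) a + sc (j && la g) a.
  by rewrite scD; case: j; case: j'; case: (la g).
rewrite -trM mulgA; congr (_ * _).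
by case: i; case: i'; rewrite //= conjMg pi_tra // -conjgM pi2 conjg1.
Qed.

Definition twisted i j : amalgam := tw_amalgam (aut_twist i j : autG (grpB :&: grpC) _).

Lemma inner_of_ext (G : {group P}) be :
  (forall be' i j, autG G be' -> {in grpI, forall g, be' g = twist i j g} -> i = false /\ j = false) ->
  (forall de, hom_bool de -> exists e, {in grpI, forall g, de g = e && la g}) ->
  grpI \subset G -> autG G be -> {in grpI, forall g, be g \in grpI} ->
  exists2 h, h \in grpI & {in grpI, forall g, be g = g ^ h}.
Proof.
move=> no_ext la_univ /subsetP sIG aut_be beI; case: (aut_be) => beM be_inj beG.
have autI : autG grpI be by split=> // [g h Ig Ih|g h Ig Ih]; [apply: beM | apply: be_inj]; apply: sIG.
have [h [i [j [Ih beE]]]] := aut_grpI_twist autI la_univ.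
have [|g Ig|i0 j0] := no_ext (fun g => be g ^ h^-1) i j.
- by apply: autG_comp (autG_conj _) aut_be; rewrite groupV sIG.
- by rewrite beE // conjgK.
by exists h => // g Ig; rewrite beE // i0 j0 /twist /= tr0 mulg1.
Qed.

Hypothesis la_univ : forall de, hom_bool de -> exists e, {in grpI, forall g, de g = e && la g}.

(** The automorphisms [be] and [ga] are inner on I by the absence of extensions, so the product of
    the two twists is inner. It then extends to B, and its bits vanish. *)
Lemma twisted_inj i j i' j' : amalgam_iso (twisted i j) (twisted i' j') -> i = i' /\ j = j'.
Proof.
case/tw_iso_aut=> be [ga [aut_be aut_ga beI gaI be_ga]].
have [h Ih beE] := inner_of_ext no_ext_B la_univ grpI_subB aut_be beI.
have [k Ik gaE] := inner_of_ext no_ext_C la_univ grpI_subC aut_ga gaI.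
have Itk := twist_I i' j' Ik; pose m := twist i' j' k * h^-1.
have Im : m \in grpI by rewrite groupM ?groupV.
have E g : g \in grpI -> twist (i (+) i') (j (+) j') g = g ^ m.
  move=> Ig; rewrite -twist_comp //; have Itg := twist_I i' j' Ig.
  have := be_ga _ Itg; rewrite beE ?twist_I // gaE // (autGJ (aut_twist i' j')) // twistK //.
  by move=> e; rewrite /m conjgM -e conjgK.
have [||e1 e2] := @no_ext_B (fun g => g ^ m) (i (+) i') (j (+) j').
- by apply: autG_conj; apply: (subsetP grpI_subB).
- by move=> g Ig; rewrite E.
by split; [move: e1; case: (i); case: (i') | move: e2; case: (j); case: (j')].
Qed.

(** For i = 0 the translation group is normal in both B and C and fixed by the twist; for i = 1
    [twist_core] applies. *)
Lemma twisted_faithful i j : faithful_amalgam (twisted i j) <-> i.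
Proof.
case: i; split=> //; last move/tw_faithful => core.
  by move=> _; apply/tw_faithful => K1 K2 *; apply: (@twist_core j K1 K2).
have gR : group_set [set tr v | v : V].
  apply/group_setP; split=> [|_ _ /imsetP[v _ ->] /imsetP[w _ ->]].
    by rewrite -(tr0 n) imset_f.
  by rewrite trM imset_f.
have sRI : [set tr v | v : V] \subset grpI.
  by apply/subsetP=> _ /imsetP[v _ ->]; apply: tr_I.
have nR (G : {group P}) : {in G, forall g, affine g} -> G \subset 'N([set tr v | v : V]).
  move=> affG; apply/subsetP=> g /affG ag; rewrite inE.
  by apply/subsetP=> _ /imsetP[_ /imsetP[v _ ->] ->]; rewrite trJ // imset_f.
have R1 : Group gR :=: 1.
  apply: (core _ (Group gR)) => //=; [exact: nR grpB_aff | exact: nR grpC_aff |].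
  rewrite -imset_comp; apply: eq_imset => v /=; by rewrite twist_tr.
have : tr a \in Group gR by rewrite imset_f.
by rewrite R1 inE -(tr0 n) (inj_eq (@tr_inj n)) (negPf nza).
Qed.

Lemma type_twisted i j : of_type_U (tr a) (tr b) (twisted i j).
Proof. exact: same_type_tw. Qed.

Lemma of_type_twisted M : of_type_U (tr a) (tr b) M -> exists i j, amalgam_iso M (twisted i j).
Proof.
case/same_type_glueing=> al [aut_al M_iso].
have [h [i [j [Ih alE]]]] := aut_grpI_twist aut_al la_univ.
by exists i, j; apply: M_iso Ih alE.
Qed.

End Twists.

Lemma four_types : exactly_up_to_iso 4 (of_type_U (tr a) (tr b)) /\
  exactly_up_to_iso 2 (fun M => of_type_U (tr a) (tr b) M /\ faithful_amalgam M).
Proof.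
have [la [hom_la [la_ex la_univ]]] := sign_character.
have inj := @twisted_inj la hom_la la_ex la_univ.
have twF := @twisted_faithful la hom_la.
have twT M := @of_type_twisted la hom_la la_univ M.
split.
  (* The low bit of k encodes i and the high bit encodes j. *)
  exists (fun k : 'I_4 => twisted hom_la (odd k) (1 < k)%N); split=> [k|k l /inj[]|M].
  - exact: type_twisted.
  - by case: k l => [[|[|[|[|k]]]] Hk] // [[|[|[|[|l]]]] Hl] //= _ _; apply: val_inj.
  case/twT=> [[] [[] M_iso]].
  - by exists (inord 3); rewrite inordK.
  - by exists (inord 1); rewrite inordK.
  - by exists (inord 2); rewrite inordK.
  - by exists (inord 0); rewrite inordK.
exists (fun k : 'I_2 => twisted hom_la true (k == 1%N :> nat)); split=> [k|k l /inj[]|M [M_type M_faithful]].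
- by split; [apply: type_twisted | apply/twF].
- by case: k l => [[|[|k]] Hk] // [[|[|l]] Hl] //= _ _; apply: val_inj.
have [i [j M_iso]] := twT M M_type.
have i1 : i by apply/(twF i j)/(faithful_iso M_iso).
exists (inord j); rewrite inordK; last by case: (j).
by rewrite i1 in M_iso; case: j M_iso.
Qed.
End DimensionFour.

(** Every gluing automorphism is inner, so gluing along the identity represents the only class. *)
Lemma unique_type : (4 < n)%N -> exactly_up_to_iso 1 (of_type_U (tr a) (tr b)).
Proof.
move=> n_gt4; exists (fun=> tw_amalgam (autG_id (grpB :&: grpC)%G)); split=> [_|i j _|M].
- exact: same_type_tw.
- by rewrite (ord1 i) (ord1 j).
case/same_type_glueing=> al [aut_al M_iso]; exists ord0.
have [h Ih alE] := aut_grpI_inner n_gt4 aut_al.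
exact: M_iso Ih alE.
Qed.
End Parabolics.

Theorem theorem4p7 :
  (forall r s : {perm 'rV['F_2]_4},
     r \in translations 4 -> s \in translations 4 ->
     r != 1 -> s != 1 -> r != s ->
     exactly_up_to_iso 4 (of_type_U r s) /\
     exactly_up_to_iso 2 (fun M => of_type_U r s M /\ faithful_amalgam M)) /\
  (forall (n : nat) (r s : {perm 'rV['F_2]_n}),
     (5 <= n)%N ->
     r \in translations n -> s \in translations n ->
     r != 1 -> s != 1 -> r != s ->
     exactly_up_to_iso 1 (of_type_U r s)).
Proof.
have tr_neq n (v w : 'rV['F_2]_n) : tr v != tr w -> v != w by apply: contraNneq => ->.
split=> [|n] r s => [|n_ge5] /translationsP[a ->] /translationsP[b ->];
  rewrite -{1}tr0 -{1}tr0 => /tr_neq nza /tr_neq nzb /tr_neq neq_ab.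
  exact: four_types.
exact: unique_type.
Qed.
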